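(* Let $\Omega$ be a bounded open domain of $\mathbb{R}^d$, $d\ge1$, let $(u_\varepsilon)_{\varepsilon>0}$ be bounded in $L^2(\Omega)$, and let $(p_n)_{n\in\mathbb{N}}$ be an increasing sequence of positive reals such that $p_{n+1}$ is an integer multiple of $p_n$ for every $n$; set $M_n:=p_n/p_0$ and $m_n:=p_n/p_{n-1}$. Let $(\varepsilon_k)$ be a decreasing sequence of positive reals converging to $0$ such that $(u_{\varepsilon_k})_k$ $p_n$-two-scale converges to $u_{0,p_n}$ for every $n\ge0$. Let $w_n$, $\widetilde{w}_n$ be the associated rearrangements and $\widetilde{w}_\infty$ the Two-Scale Shuffle limit. Then $u_{0,p_n}$ can be recovered from $\widetilde{w}_\infty$ as follows, for every $n\ge 0$: (1) for all $\beta\in\{0,\dots,M_n-1\}^d$, all $y'\in\prod_{i=1}^d[\beta_i/M_n,(\beta_i+1)/M_n[$ and almost all $(x,y)\in\Omega\times[0,p_0]^d$, $$\widetilde{w}_n(x,y,y')=M_n^d\int_{\prod_{i=1}^d[\frac{\beta_i}{M_n},\frac{\beta_i+1}{M_n}[}\widetilde{w}_\infty(x,y,z')\,dz';$$ (2) the shuffle function $H_n$ is one-to-one from $[0,1[^d$ onto $[0,1[^d$, and $w_n(x,y,y')=\widetilde{w}_n(x,y,H_n^{-1}(y'))$; (3) for almost all $(x,y)\in\Omega\times[0,p_n[^d$, $u_{0,p_n}(x,y)$ is equal to the constant value taken by $y'\mapsto w_n(x,\,y-p_0\lfloor y/p_0\rfloor,\,y')$ when $y'$ belongs to the hypercube $\prod_{i=1}^d\big[\lfloor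 y_i/p_0\rfloor/M_n,\,(\lfloor y_i/p_0\rfloor+1)/M_n\big[$.
   Context: Two-scale convergence. For $p>0$ let $Y_p=[0,p]^d$ and let $\mathcal{C}_\#(Y_p)$ be the set of continuous functions on $\mathbb{R}^d$ that are $p$-periodic in each variable. A sequence $(u_{\varepsilon_k})_k$ in $L^2(\Omega)$, with $\varepsilon_k\to0$, $p$-two-scale converges to $u_{0,p}\in L^2(\Omega\times Y_p)$ if $$\lim_{k\to\infty}\int_\Omega u_{\varepsilon_k}(x)\,\psi\Big(x,\frac{x}{\varepsilon_k}\Big)dx=\frac1{p^d}\int_\Omega\int_{Y_p}u_{0,p}(x,y)\psi(x,y)\,dy\,dx$$ for all $\psi\in L^2(\Omega;\mathcal{C}_\#(Y_p))$. The function $u_{0,p}$ is identified with its extension to $\Omega\times\mathbb{R}^d$ that is $p$-periodic in each of the last $d$ variables. Shuffle function $H_n$. For positive integers $M,m$, define $$R_{M,m}:\{0,\dots,Mm-1\}\to\{0,\dots,Mm-1\},\quad R_{M,m}(i)=M\cdot(i\bmod m)+\lfloor i/m\rfloor,$$ $$h^*_{M,m}:[0,1[\to[0,1[,\quad h^*_{M,m}(y')=\frac{R_{M,m}(\lfloor Mmy'\rfloor)}{Mm}+\Big(y'-\frac{\lfloor Mmy'\rfloor}{Mm}\Big).$$ Set $H^*_n:=h^*_{M_{n-1},m_n}\circ\dots\circ h^*_{M_1,m_2}\circ h^*_{M_0,m_1}$ (with $H_0^*$ the identity), and $H_n:[0,1[^d\to[0,1[^d$, $H_n(y'_1,\dots,y'_d)=(H^*_n(y'_1),\dots,H^*_n(y'_d))$.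 The floor of a vector is taken componentwise. Rearrangements. For $x\in\Omega$, $y\in[0,p_0]^d$, $y'\in[0,1[^d$, $$w_n(x,y,y'):=u_{0,p_n}\big(x,\;y+p_0\lfloor M_ny'\rfloor\big),\qquad \widetilde{w}_n(x,y,y'):=w_n(x,y,H_n(y')).$$ The sequence $(\widetilde{w}_n)$ converges strongly in $L^2(\Omega\times[0,p_0]^d\times[0,1]^d)$ and almost everywhere; its limit $\widetilde{w}_\infty$ is called the Two-Scale Shuffle limit. *)

(* Defs.v *)
From HB Require Import structures.
From mathcomp Require Import all_boot all_order all_algebra.
From mathcomp Require Import all_classical all_reals all_analysis.
Set Implicit Arguments.
Unset Strict Implicit.
Unset Printing Implicit Defensive.
Import Order.TTheory GRing.Theory Num.Theory.
Import numFieldNormedType.Exports.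
Local Open Scope classical_set_scope.
Local Open Scope ring_scope.

(* Same construction as the library's product sigma-algebra on n.-tuple T; the
   carrier is 'rV[T]_n because tuples carry no topology. For T := R this is the
   Borel sigma-algebra of R^n. *)
Definition measure_rV_display : measure_display -> measure_display.
Proof. exact. Qed.

Section measurable_rV.
Context {d : measure_display} {T : measurableType d} (n : nat).

Let coord (i : 'I_n) (v : 'rV[T]_n) : T := v ord0 i.

Let rV_set0 : g_sigma_preimage coord set0.
Proof. exact: sigma_algebra0. Qed.

Let rV_setC A : g_sigma_preimage coord A -> g_sigma_preimage coord (~` A).
Proof. exact: sigma_algebraC. Qed.

Let rV_bigcup (F : (set 'rV[T]_n)^nat) :
  (forall i, g_sigma_preimage coord (F i)) ->
  g_sigma_preimage coord (\bigcup_i (F i)).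
Proof. exact: sigma_algebra_bigcup. Qed.

HB.instance Definition _ := @isMeasurable.Build (measure_rV_display d)
  'rV[T]_n (g_sigma_preimage coord) rV_set0 rV_setC rV_bigcup.

End measurable_rV.

Lemma measurable_coord d (T : measurableType d) n (i : 'I_n) :
  measurable_fun [set: 'rV[T]_n] (fun v => v ord0 i).
Proof.
move=> _ Y mY; rewrite setTI; apply: sub_sigma_algebra => /=.
rewrite -bigcup_seq/=; exists i => /=; first by rewrite mem_index_enum.
by exists Y => //; rewrite setTI.
Qed.

Lemma measurable_fun_rV d d' (T : measurableType d) (T' : measurableType d') n
    (f : T' -> 'rV[T]_n) :
  (forall i, measurable_fun [set: T'] (fun t => f t ord0 i)) ->
  measurable_fun [set: T'] f.
Proof.
move=> mf; apply: (@measurability _ _ _ _ _ _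
  (\big[setU/set0]_(i < n) preimage_set_system setT
    (fun v : 'rV[T]_n => v ord0 i) measurable)) => //.
move=> _ [A + <-]; rewrite -bigcup_seq => -[i _ [B mB <-]].
by rewrite !setTI -comp_preimage -[X in measurable X]setTI; exact: mf.
Qed.

Section lebesgue_rV.
Context {R : realType}.

Definition rV_cons n (z : measurableTypeR R * 'rV[R]_n) :
    'rV[R]_n.+1 :=
  \row_i (if unlift ord0 i is Some j then z.2 ord0 j else z.1).

Definition rV_uncons n (v : 'rV[R]_n.+1) :
    measurableTypeR R * 'rV[R]_n :=
  (v ord0 ord0, \row_j v ord0 (lift ord0 j)).

Lemma rV_consK n : cancel (@rV_cons n) (@rV_uncons n).
Proof.
move=> [x v]; rewrite /rV_cons /rV_uncons mxE unlift_none; congr pair.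
by apply/rowP => j; rewrite !mxE liftK.
Qed.

Lemma measurable_rV_cons n : measurable_fun setT (@rV_cons n).
Proof.
apply: measurable_fun_rV => i; case: (unliftP ord0 i) => [j ->|->].
  rewrite [X in measurable_fun _ X](_ : _ = (fun v : 'rV_n => v ord0 j) \o snd).
    by apply: measurableT_comp => //; exact: measurable_coord.
  by apply/funext => z; rewrite mxE liftK.
rewrite [X in measurable_fun _ X](_ : _ = fst) //.
by apply/funext => z; rewrite mxE unlift_none.
Qed.

Lemma measurable_rV_uncons n : measurable_fun setT (@rV_uncons n).
Proof.
apply: measurable_fun_pair; first exact: measurable_coord.
apply: measurable_fun_rV => j.
rewrite [X in measurable_fun _ X](_ : _ = fun v : 'rV_n.+1 => v ord0 (lift ord0 j)).
  exact: measurable_coord.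
by apply/funext => v; rewrite mxE.
Qed.

Section step.
Context (n : nat).
Variable mu : {sigma_finite_measure set 'rV[R]_n -> \bar R}.

Definition lebesgue_rV_step : set 'rV[R]_n.+1 -> \bar R :=
  pushforward (@lebesgue_measure R \x mu)%E (@rV_cons n).

Let step0 : lebesgue_rV_step set0 = 0%E.
Proof. by rewrite /lebesgue_rV_step /pushforward preimage_set0 measure0. Qed.

Let step_ge0 A : (0 <= lebesgue_rV_step A)%E.
Proof. by rewrite /lebesgue_rV_step /pushforward measure_ge0. Qed.

Let step_sigma_additive : semi_sigma_additive lebesgue_rV_step.
Proof.
exact: (@measure_semi_sigma_additive _ _ _
  (measure_function_pushforward__canonical__measure_function_Measure
    (lebesgue_measure \x mu)%E (@measurable_rV_cons n))).
Qed.

HB.instance Definition _ := isMeasure.Build _ _ _ lebesgue_rV_step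
  step0 step_ge0 step_sigma_additive.

Let step_sigma_finite : sigma_finite setT lebesgue_rV_step.
Proof.
have /sigma_finiteP[F [TF ndF Foo]] := sigma_finiteT (@lebesgue_measure R).
have /sigma_finiteP[G [TG ndG Goo]] := sigma_finiteT mu.
exists (fun k => @rV_uncons n @^-1` (F k `*` G k)).
  rewrite -preimage_bigcup -(_ : setT = \bigcup_k (F k `*` G k)) ?preimage_setT//.
  rewrite -setXTT TF TG predeqE => -[x y]; split.
    move=> [/= [i _ Fix] [k _ Gky]]; exists (maxn i k) => //; split.
    - by move: x Fix; exact/subsetPset/ndF/leq_maxl.
    - by move: y Gky; exact/subsetPset/ndG/leq_maxr.
  by move=> [i _ []/= ? ?]; split; exists i.
move=> k; have [mFk Fkoo] := Foo k; have [mGk Gkoo] := Goo k; split.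
  rewrite -[X in measurable X]setTI.
  by apply: (@measurable_rV_uncons n) => //; exact: measurableX.
rewrite /lebesgue_rV_step /pushforward -comp_preimage.
rewrite (_ : _ \o _ = id) ?preimage_id; last by apply/funext => z; exact: rV_consK.
by rewrite product_measure1E// lte_mul_pinfty// ge0_fin_numE.
Qed.

HB.instance Definition _ := Measure_isSigmaFinite.Build _ _ _ lebesgue_rV_step
  step_sigma_finite.

End step.

Fixpoint lebesgue_rV (n : nat) :
    {sigma_finite_measure set 'rV[R]_n -> \bar R} :=
  match n with
  | 0 => @dirac _ 'rV[R]_0 0 R
  | n'.+1 => lebesgue_rV_step (lebesgue_rV n')
  end.

End lebesgue_rV.

Lemma measurable_box (R : realType) n (A : 'I_n -> set R) :
  (forall i, measurable (A i)) ->
  measurable [set v : 'rV[R]_n | forall i, A i (v ord0 i)].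
Proof.
move=> mA; rewrite [X in measurable X](_ : _ =
  \bigcap_(i in [set: 'I_n]) ((fun v : 'rV[R]_n => v ord0 i) @^-1` A i));
  last first.
  apply/seteqP; split=> v /= H i; first by move=> _; exact: H.
  exact: (H i I).
apply: fin_bigcap_measurable; first exact: finite_finset.
move=> i _; rewrite -[X in measurable X]setTI; have := @measurable_coord _ R n i.
by apply => //; exact: mA.
Qed.

Lemma lebesgue_rV_box (R : realType) n (A : 'I_n -> set R) :
  (forall i, measurable (A i)) ->
  lebesgue_rV n [set v : 'rV[R]_n | forall i, A i (v ord0 i)]
  = (\prod_(i < n) lebesgue_measure (A i))%E.
Proof.
elim: n A => [|n IH] A mA.
  rewrite big_ord0 /= diracE mem_set//=; by case.
rewrite big_ord_recl -IH /=; last by move=> i; exact: mA.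
rewrite /lebesgue_rV_step /pushforward -product_measure1E//=; last first.
  by apply: (@measurable_box R n (fun i => A (lift ord0 i))) => i; exact: mA.
  exact: mA.
congr (_ _); apply/seteqP; split=> -[x v] /= H.
- by split=> [|i]; [have := H ord0|have := H (lift ord0 i)]; rewrite mxE ?unlift_none ?liftK.
- case: H => H0 H i; rewrite mxE; case: (unliftP ord0 i) => [j ->|->] //=; exact: H.
Qed.

Section two_scale.
Context {R : realType} {d : nat}.
Implicit Types (Omega : set 'rV[R]_d) (p q : R).

Local Notation mu := (@lebesgue_rV R d).

Definition L2 (disp : measure_display) (T : measurableType disp)
    (nu : {measure set T -> \bar R}) (D : set T) (f : T -> R) : Prop :=
  f \_ D \in Lfun nu 2%:E.

Definition L2norm (disp : measure_display) (T : measurableType disp)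
    (nu : {measure set T -> \bar R}) (D : set T) (f : T -> R) : \bar R :=
  'N[nu]_2%:E[EFin \o (f \_ D)]%E.

Definition cube_cc q : set 'rV[R]_d :=
  [set y | forall i, 0 <= y ord0 i <= q].

Definition cube_co q : set 'rV[R]_d :=
  [set y | forall i, 0 <= y ord0 i < q].

Definition periodic_rV q (g : 'rV[R]_d -> R) : Prop :=
  forall i y, g (y + q *: delta_mx ord0 i) = g y.

Definition Cper q : set ('rV[R]_d -> R) :=
  [set g | continuous g /\ periodic_rV q g].

Definition supnorm (g : 'rV[R]_d -> R) : R :=
  sup (range (fun y => `|g y|)).

Definition Cper_simple Omega q (s : 'rV[R]_d -> 'rV[R]_d -> R) : Prop :=
  [/\ forall x, Omega x -> Cper q (s x),
      finite_set (s @` Omega) &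
      forall g, measurable (Omega `&` s @^-1` [set g])].

(* The Bochner space L^2(Omega; Cper q): a.e. limits, in the sup norm, of
   simple functions, with square-integrable norm. *)
Definition L2_Cper Omega q (psi : 'rV[R]_d -> 'rV[R]_d -> R) : Prop :=
  [/\ forall x, Omega x -> Cper q (psi x),
      exists s : nat -> 'rV[R]_d -> 'rV[R]_d -> R,
        (forall j, Cper_simple Omega q (s j)) /\
        {ae mu, forall x, Omega x ->
          supnorm (fun y => s j x y - psi x y) @[j --> \oo] --> (0 : R)} &
      (\int[mu]_(x in Omega) (supnorm (psi x) ^+ 2)%:E < +oo)%E].

(* u0 is the representative extended q-periodically in its second variable. *)
Definition two_scale_cvg Omega q (eps : nat -> R)
    (u : nat -> 'rV[R]_d -> R) (u0 : 'rV[R]_d -> 'rV[R]_d -> R) : Prop :=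
  [/\ forall x, Omega x -> periodic_rV q (u0 x),
      L2 (mu \x mu)%E (Omega `*` cube_cc q) (fun z => u0 z.1 z.2) &
      forall psi, L2_Cper Omega q psi ->
        \int[mu]_(x in Omega) (u k x * psi x ((eps k)^-1 *: x))
          @[k --> \oo] -->
        (q ^+ d)^-1 * \int[mu]_(x in Omega)
          (\int[mu]_(y in cube_cc q) (u0 x y * psi x y))].

Definition floor_rV (y : 'rV[R]_d) : 'rV[R]_d :=
  \row_i (Num.floor (y ord0 i))%:~R.

Definition shuffle_idx (M m i : nat) : nat := (M * (i %% m) + i %/ m)%N.

Definition shuffle1 (M m : nat) (t : R) : R :=
  let i := Num.truncn ((M * m)%:R * t) in
  (shuffle_idx M m i)%:R / (M * m)%:R + (t - i%:R / (M * m)%:R).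

Section scales.
Variable p : nat -> R.

(* The ratios are natural numbers when p n.+1 is an integer multiple of p n;
   truncn then only changes the type. step_ratio n stands for m_(n+1). *)
Definition period_ratio (n : nat) : nat := Num.truncn (p n / p 0%N).

Definition step_ratio (n : nat) : nat := Num.truncn (p n.+1 / p n).

Fixpoint shuffle (n : nat) : R -> R :=
  if n is n'.+1 then shuffle1 (period_ratio n') (step_ratio n') \o shuffle n'
  else id.

Definition shuffle_rV (n : nat) (y' : 'rV[R]_d) : 'rV[R]_d :=
  \row_i shuffle n (y' ord0 i).

Definition rearr (u0 : nat -> 'rV[R]_d -> 'rV[R]_d -> R) (n : nat)
    (x y y' : 'rV[R]_d) : R :=
  u0 n x (y + p 0%N *: floor_rV ((period_ratio n)%:R *: y')).

Definition shuffled u0 (n : nat) (x y y' : 'rV[R]_d) : R :=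
  rearr u0 n x y (shuffle_rV n y').

Definition subcube (n : nat) (b : 'rV[R]_d) : set 'rV[R]_d :=
  [set y' | forall i, b ord0 i / (period_ratio n)%:R <= y' ord0 i
                      < (b ord0 i + 1) / (period_ratio n)%:R].

Definition is_shuffle_limit Omega (u0 : nat -> 'rV[R]_d -> 'rV[R]_d -> R)
    (winf : 'rV[R]_d -> 'rV[R]_d -> 'rV[R]_d -> R) : Prop :=
  let nu := ((mu \x mu) \x mu)%E in
  let D := (Omega `*` cube_cc (p 0%N)) `*` cube_cc 1 in
  [/\ L2 nu D (fun z => winf z.1.1 z.1.2 z.2),
      L2norm nu D (fun z => shuffled u0 n z.1.1 z.1.2 z.2
                            - winf z.1.1 z.1.2 z.2)
        @[n --> \oo] --> 0%E &
      {ae nu, forall z, D z ->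
        shuffled u0 n z.1.1 z.1.2 z.2 @[n --> \oo] -->
        winf z.1.1 z.1.2 z.2}].

End scales.
End two_scale.

(* Main.v *)
Require Import Defs.
From HB Require Import structures.
From mathcomp Require Import all_boot all_order all_algebra.
From mathcomp Require Import all_classical all_reals all_analysis.
From mathcomp Require Import measurable_realfun lra ring zify.
Set Implicit Arguments.
Unset Strict Implicit.
Unset Printing Implicit Defensive.
Import Order.TTheory GRing.Theory Num.Theory.
Import numFieldNormedType.Exports.
Local Open Scope classical_set_scope.
Local Open Scope ring_scope.

(** The shuffle [H_n] permutes the [M_n ^ d] cells of side [1 / M_n] of the unit
    cube and translates each of them ([shuffleE]). Its bijectivity, and the
    recovery of [u0 n] from the rearranged function, follow from this description
    by inspection. It also shows that the [n]-th shuffled function depends on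
    [y'] only through its cell: on the cell of index [b] its value is
    [cell_value n b (x, y) = u0 n x (y + p_0 * cell_perm n b)]. The permutation is
    such that, on the cells of level [n + 1] inside the cell [b], the
    [(n + 1)]-st function takes the values of [u0 (n + 1)] at the translates of
    this point by multiples of [p_n].

    The averaging identity is a martingale property. A [p_n]-periodic test
    function is also [p_(n+1)]-periodic, so the two-scale limits with periods
    [p_n] and [p_(n+1)] of the same sequence have the same averaged integrals
    against it. Hence [u0 n x y] is, almost everywhere, the average of
    [u0 (n + 1)] over the translates of [y] by multiples of [p_n]
    ([two_scale_average]). This uses that an integrable function on [Omega] times
    the period cell is determined by its integrals against products of an
    indicator in [x] and a continuous periodic function in [y]
    ([periodic_test_ae0]): such functions, built from trigonometric ones,
    approximate the indicators of a pi-system generating the Borel sets of the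
    cell. Iterating, the value of the [n]-th shuffled function on a cell is the
    average of the [k]-th one over that cell for every [k >= n]
    ([cell_average]).

    It remains to let [k] tend to infinity. On a set of finite measure
    convergence in [L^2] implies convergence in [L^1], so by Fubini the integrals
    of the shuffled functions over the cell tend in [L^1] in [(x, y)] to that of
    the shuffle limit; being eventually constant in [k], they are equal to it
    almost everywhere ([ae_section_integral_limit], [shuffle_limit_average]). *)

(** * Boxes and the Lebesgue measure of R^n *)

Section boxes.
Context {R : realType}.

(** The box with sides [A i]. *)
Definition box n (A : 'I_n -> set R) : set 'rV[R]_n :=
  [set v | forall i, A i (v ord0 i)].

Lemma boxI n (A B : 'I_n -> set R) :
  box A `&` box B = box (fun i => A i `&` B i).
Proof.
apply/seteqP; split => v; first by move=> [HA HB] i; split; [exact: HA|exact: HB].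
by move=> H; split=> i; have [] := H i.
Qed.

Lemma ler_coord_norm n (v : 'rV[R]_n) i : `|v ord0 i| <= `|v|.
Proof.
rewrite [leRHS]mx_normrE.
exact: (le_bigmax _ (fun ij : 'I_1 * 'I_n => `|v ij.1 ij.2|) (ord0, i)).
Qed.

(** As [G] contains the whole line, the inverse image of a set of [G] under a
    coordinate is itself a box. *)
Lemma measurable_rV_gen n (G : set (set R)) : G setT ->
  (measurable : set (set (measurableTypeR R))) = <<s G >> ->
  (measurable : set (set 'rV[R]_n)) =
  <<s [set box A | A in [set A : 'I_n -> set R | forall i, G (A i)]] >>.
Proof.
move=> GT mG; apply/seteqP; split.
  apply: smallest_sub; first exact: smallest_sigma_algebra.
  move=> X; rewrite -bigcup_seq /= => -[i _ [B mB <-]]; rewrite setTI.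
  have GB : <<s G >> B by rewrite -mG.
  pose H := [set B | <<s [set box A | A in
     [set A : 'I_n -> set R | forall i, G (A i)]] >>
     ((fun v : 'rV[R]_n => v ord0 i) @^-1` B)].
  suff: <<s G >> `<=` H by exact.
  apply: smallest_sub.
    split=> [|C /= HC|F /= HF].
    - by rewrite /H /= preimage_set0; exact: sigma_algebra0.
    - by rewrite /H /= setTD -preimage_setC; exact: sigma_algebraC.
    - by rewrite /H /= preimage_bigcup; exact: sigma_algebra_bigcup.
  move=> C GC; apply: sub_sigma_algebra => /=.
  exists (fun j => if j == i then C else setT) => /= [j|]; first by case: ifP.
  apply/seteqP; split=> v /=; first by move=> /(_ i); rewrite eqxx.
  by move=> Cv j; case: eqP => [->|].
apply: smallest_sub; first exact: sigma_algebra_measurable.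
move=> _ [A GA <-]; apply: measurable_box => i.
have : <<s G >> (A i) by exact: sub_sigma_algebra.
by rewrite -mG.
Qed.

Lemma measurable_box_unique n (m1 m2 : {measure set 'rV[R]_n -> \bar R}) :
  (forall k : nat, (m1 (box (fun=> `[(- k%:R)%R, k%:R%R]%classic)) < +oo)%E) ->
  (forall A : 'I_n -> set R, (forall i, measurable (A i)) ->
    m1 (box A) = m2 (box A)) ->
  forall E, measurable E -> m1 E = m2 E.
Proof.
move=> fin H; apply: (@measure_unique _ _ _
  [set box A | A in [set A : 'I_n -> set R | forall i, measurable (A i)]]
  (fun k => box (fun=> `[- k%:R, k%:R]%classic))) => //.
- have mT := sigma_algebra_measurable (measurableTypeR R).
  apply: (@measurable_rV_gen n (measurable : set (set (measurableTypeR R)))) => //.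
  by rewrite sigma_algebra_id.
- move=> _ _ [A mA <-] [B mB <-]; rewrite boxI.
  exists (fun i => A i `&` B i) => // i.
  by apply: measurableI; [exact: mA|exact: mB].
- by move=> i; exists (fun=> `[- i%:R, i%:R]%classic) => // j; exact: measurable_itv.
- apply/seteqP; split=> // v _.
  exists (Num.truncn `|v|).+1 => // i /=; rewrite in_itv /= -ler_norml.
  apply: le_trans (ltW (truncnS_gt _)).
  exact: ler_coord_norm.
- by move=> _ [A mA <-]; exact: H.
Qed.

Lemma lebesgue_measure_translate (c : R) (A : set R) : measurable A ->
  lebesgue_measure ((fun x => x + c) @^-1` A) = lebesgue_measure A.
Proof.
move=> mA.
pose tc (x : measurableTypeR R) : measurableTypeR R := x + c.
have mt : measurable_fun setT tc by exact: measurable_funD.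
rewrite -[LHS]/(pushforward lebesgue_measure tc A).
apply/esym/lebesgue_measure_unique => //= _ [[a b]] _ <-.
rewrite /pushforward /tc /=.
rewrite (_ : _ @^-1` _ = `]a - c, b - c]%classic); last first.
  by apply/seteqP; split=> x /=; rewrite !in_itv /= ltrBlDr lerBrDr.
rewrite !lebesgue_measure_itv /= !lte_fin ltrD2r; case: ifP => // _.
by rewrite -!EFinB; congr EFin; lra.
Qed.

Lemma measurable_translate n (c : 'rV[R]_n) :
  measurable_fun setT (fun y : 'rV[R]_n => y + c).
Proof.
apply: measurable_fun_rV => i.
rewrite (_ : (fun t => _) = (fun t : 'rV[R]_n => t ord0 i + c ord0 i)).
  by apply: measurable_funD => //; exact: measurable_coord.
by apply/funext => t; rewrite !mxE.
Qed.

Lemma lebesgue_box_lt_pinfty n (A : 'I_n -> set R) :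
  (forall i, measurable (A i)) -> (forall i, lebesgue_measure (A i) < +oo)%E ->
  (lebesgue_rV n (box A) < +oo)%E.
Proof.
move=> mA fA; rewrite lebesgue_rV_box //.
suff /andP[] : (0 <= \prod_(i < n) lebesgue_measure (A i) < +oo)%E by [].
elim/big_ind : _ => [|x y /andP[x0 xo] /andP[y0 yo]|i _].
- by rewrite lee01 ltry.
- by rewrite mule_ge0 // lte_mul_pinfty // ge0_fin_numE.
- by rewrite measure_ge0 fA.
Qed.

Lemma lebesgue_rV_translate n (c : 'rV[R]_n) (E : set 'rV[R]_n) : measurable E ->
  lebesgue_rV n ((fun y => y + c) @^-1` E) = lebesgue_rV n E.
Proof.
move=> mE.
rewrite -[LHS]/(pushforward (lebesgue_rV n) (fun y : 'rV[R]_n => y + c) E).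
have mt := @measurable_translate n c.
apply/esym.
apply: (@measurable_box_unique n (lebesgue_rV n)
  (measure_function_pushforward__canonical__measure_function_Measure
    (lebesgue_rV n) mt)) mE => [k|A mA].
  apply: lebesgue_box_lt_pinfty => i; first exact: measurable_itv.
  by rewrite lebesgue_measure_itv; case: ifP => // _; rewrite -EFinB ltry.
rewrite /= /pushforward.
rewrite (_ : _ @^-1` _ = box (fun i => (fun x => x + c ord0 i) @^-1` A i)); last first.
  by apply/seteqP; split=> v H i; have := H i; rewrite /= mxE.
rewrite !lebesgue_rV_box//.
  by apply: eq_bigr => i _; rewrite lebesgue_measure_translate.
move=> i; pose tc (x : measurableTypeR R) : measurableTypeR R := x + c ord0 i.
have mt1 : measurable_fun setT tc by exact: measurable_funD.
by rewrite -[X in measurable X]setTI; apply: mt1 => //; exact: mA.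
Qed.

Lemma prod_lebesgue_translate n (c : 'rV[R]_n) (E : set ('rV[R]_n * 'rV[R]_n)) :
  measurable E ->
  (lebesgue_rV n \x lebesgue_rV n)%E ((fun z => (z.1, z.2 + c)) @^-1` E) =
  (lebesgue_rV n \x lebesgue_rV n)%E E.
Proof.
move=> mE.
have mt : measurable_fun setT (fun z : 'rV[R]_n * 'rV[R]_n => (z.1, z.2 + c)).
  apply: measurable_fun_pair => //.
  apply: (@measurableT_comp _ _ _ _ _ _ (fun y : 'rV[R]_n => y + c)) => //.
  exact: measurable_translate.
rewrite -[LHS]/(pushforward (lebesgue_rV n \x lebesgue_rV n)%E
  (fun z : 'rV[R]_n * 'rV[R]_n => (z.1, z.2 + c)) E).
apply/esym.
apply: (@product_measure_unique _ _ _ _ _ (lebesgue_rV n) (lebesgue_rV n)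
  (measure_function_pushforward__canonical__measure_function_Measure
    (lebesgue_rV n \x lebesgue_rV n)%E mt)) => // A B mA mB.
rewrite /= /pushforward (_ : _ @^-1` _ = A `*` ((fun y => y + c) @^-1` B)) //.
rewrite product_measure1E //; first by rewrite lebesgue_rV_translate.
by rewrite -[X in measurable X]setTI; apply: measurable_translate.
Qed.

(** An open set is the union of the boxes with rational centre and side
    [2 / (k + 1)] that it contains. *)
Lemma open_measurable_rV n (U : set 'rV[R]_n) : open U -> measurable U.
Proof.
move=> oU.
pose B (i : 'rV[rat]_n * nat) : set 'rV[R]_n :=
  box (fun j => `](ratr (i.1 ord0 j) - i.2.+1%:R^-1),
                  (ratr (i.1 ord0 j) + i.2.+1%:R^-1)[%classic).
pose F i := if `[< B i `<=` U >] then B i else set0.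
rewrite (_ : U = \bigcup_i F i); last first.
  apply/seteqP; split => [v Uv|v [i _]]; last first.
    by rewrite /F; case: asboolP => // + Biv; exact.
  have /nbhs_ballP[e /= e0 eU] := open_nbhs_nbhs (conj oU Uv).
  have [k ke] : exists k : nat, k.+1%:R^-1 < e / 2.
    have := @near_infty_natSinv_lt R (PosNum (divr_gt0 e0 (ltr0n _ 2))).
    by case=> N _ HN; exists N; exact: (HN N (leqnn N)).
  have k0 : 0 < k.+1%:R^-1 :> R by rewrite invr_gt0.
  have : forall j, exists r : rat, v ord0 j - k.+1%:R^-1 < ratr r < v ord0 j + k.+1%:R^-1.
    move=> j; have [] := @rat_in_itvoo R (v ord0 j - k.+1%:R^-1) (v ord0 j + k.+1%:R^-1).
      by rewrite ltrBlDr -addrA ltrDl addr_gt0.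
    by move=> r; rewrite in_itv /=; exists r.
  move=> /choice[r Hr].
  have Bv : B (\row_j r j, k) v.
    move=> j; rewrite /= in_itv /= mxE; have /andP[H1 H2] := Hr j.
    by rewrite ltrBlDr H2 -ltrBlDr H1.
  exists (\row_j r j, k) => //; rewrite /F; case: asboolP => // H; exfalso; apply: H.
  move=> w Bw; apply: eU; split => // i j; rewrite ord1 /ball /= => {i}.
  have := Bv j; have := Bw j; rewrite /= !in_itv /= mxE => /andP[H1 H2] /andP[H3 H4].
  have dist_lt (a b c f : R) : a - f < c -> c < a + f -> a - f < b -> b < a + f ->
      f < e / 2 -> b - e < c < b + e.
    by move=> ? ? ? ? ?; apply/andP; split; lra.
  by rewrite ltr_distlC; exact: dist_lt H1 H2 H3 H4 ke.
apply: countable_bigcupT_measurable; first exact: countableP.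
move=> i; rewrite /F; case: asboolP => // _; apply: measurable_box => j.
exact: measurable_itv.
Qed.

Lemma bounded_lebesgue_lt_pinfty n (U : set 'rV[R]_n) :
  measurable U -> bounded_set U -> (lebesgue_rV n U < +oo)%E.
Proof.
move=> mU [M [Mr HM]]; have {}HM := HM (M + 1) _.
pose B := box (fun=> `[- (M + 1), M + 1]%classic) : set 'rV[R]_n.
have UB : U `<=` B.
  move=> v Uv i; rewrite /= in_itv /= -ler_norml.
  apply: le_trans (HM _ v Uv); first exact: ler_coord_norm.
  by rewrite ltrDl.
have mB : measurable B by apply: measurable_box => i; exact: measurable_itv.
apply: (@le_lt_trans _ _ (lebesgue_rV n B)).
  by apply: le_measure; rewrite ?inE.
apply: lebesgue_box_lt_pinfty => i; first exact: measurable_itv.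
by rewrite lebesgue_measure_itv; case: ifP => // _; rewrite -EFinB ltry.
Qed.

End boxes.

(** * The shuffle function as a permutation of cells *)

Section shuffle_cells.
Context {R : realType}.
Variable p : nat -> R.
Hypothesis p_gt0 : forall n, 0 < p n.
Hypothesis p_mult : forall n, exists k : int, p n.+1 = k%:~R * p n.

Local Notation M := (period_ratio p).
Local Notation m := (step_ratio p).

Lemma step_ratioE n : p n.+1 = (m n)%:R * p n.
Proof.
have [k pk] := p_mult n.
have k0 : 0 <= k.
  have : 0 < k%:~R * p n by rewrite -pk.
  by rewrite pmulr_lgt0 // ltr0z => /ltW.
rewrite /step_ratio pk mulfK ?gt_eqF //.
by case: k k0 {pk} => // k _; rewrite -[k%:~R]/(k%:R) natrK.
Qed.

Lemma step_ratio_gt0 n : (0 < m n)%N.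
Proof.
have := p_gt0 n.+1; rewrite step_ratioE pmulr_lgt0 //.
by rewrite ltr0n.
Qed.

Lemma period_ratio0 : M 0%N = 1%N.
Proof. by rewrite /period_ratio divff ?gt_eqF // truncn1. Qed.

Lemma period_ratioE n : p n = (M n)%:R * p 0%N.
Proof.
suff [k pk] : exists k : nat, p n = k%:R * p 0%N.
  by rewrite /period_ratio {2}pk mulfK ?gt_eqF // natrK.
elim: n => [|n [k pk]]; first by exists 1%N; rewrite mul1r.
by exists (m n * k)%N; rewrite step_ratioE pk natrM mulrA.
Qed.

Lemma period_ratioS n : M n.+1 = (M n * m n)%N.
Proof.
have p0 := p_gt0 0%N.
apply/eqP; rewrite -(eqr_nat R) natrM; apply/eqP.
apply: (@mulIf _ (p 0%N)); first by rewrite gt_eqF.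
by rewrite -period_ratioE step_ratioE (period_ratioE n) [RHS]mulrAC [RHS]mulrC.
Qed.

Lemma period_ratio_gt0 n : (0 < M n)%N.
Proof.
by elim: n => [|n IH]; rewrite ?period_ratio0 // period_ratioS muln_gt0 IH step_ratio_gt0.
Qed.

(** The cell of index [cell_perm n i] among the intervals of length [1 / M n]
    is the image under the n-th shuffle of the cell of index [i]. *)
Fixpoint cell_perm (n i : nat) : nat :=
  if n is n'.+1 then (M n' * (i %% m n') + cell_perm n' (i %/ m n'))%N else i.

Lemma cell_perm_lt n i : (i < M n)%N -> (cell_perm n i < M n)%N.
Proof.
elim: n i => [//|n IH] i; rewrite period_ratioS => iM /=.
have m0 := step_ratio_gt0 n.
have im : (i %/ m n < M n)%N by rewrite ltn_divLR.
have sM := IH _ im; have rm := ltn_pmod i m0.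
by nia.
Qed.

Lemma cell_perm_inj n i j : (i < M n)%N -> (j < M n)%N ->
  cell_perm n i = cell_perm n j -> i = j.
Proof.
elim: n i j => [//|n IH] i j; rewrite period_ratioS => iM jM /= eq.
have m0 := step_ratio_gt0 n; have M0 := period_ratio_gt0 n.
have im : (i %/ m n < M n)%N by rewrite ltn_divLR.
have jm : (j %/ m n < M n)%N by rewrite ltn_divLR.
have := congr1 (divn^~ (M n)) eq; have := congr1 (modn^~ (M n)) eq => /=.
rewrite ![(M n * _)%N]mulnC !modnMDl !divnMDl //.
have ci := cell_perm_lt im; have cj := cell_perm_lt jm.
rewrite (modn_small ci) (modn_small cj) (divn_small ci) (divn_small cj) !addn0.
move=> /(IH _ _ im jm) dE mE.
by rewrite (divn_eq i (m n)) (divn_eq j (m n)) dE mE.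
Qed.

Lemma cell_perm_surj n j : (j < M n)%N -> exists2 i, (i < M n)%N & cell_perm n i = j.
Proof.
move=> jM.
have f_inj : injective (fun i : 'I_(M n) => Ordinal (cell_perm_lt (ltn_ord i))).
  by move=> i k [] /cell_perm_inj ik; apply: val_inj; exact: ik.
have [g _ gK] := injF_bij f_inj.
by exists (g (Ordinal jM)) => //; have [] := gK (Ordinal jM).
Qed.

(** The [n]-th shuffle translates each interval of length [1 / M n]. *)
Lemma shuffleE n i (t : R) : (i < M n)%N ->
  i%:R / (M n)%:R <= t < (i%:R + 1) / (M n)%:R ->
  shuffle p n t = t + ((cell_perm n i)%:R - i%:R) / (M n)%:R.
Proof.
elim: n i t => [|n IH] i t; first by rewrite subrr mul0r addr0.
rewrite period_ratioS natrM => iM it /=.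
have m0 := step_ratio_gt0 n; have M0 := period_ratio_gt0 n.
have m0R : 0 < (m n)%:R :> R by rewrite ltr0n.
have M0R : 0 < (M n)%:R :> R by rewrite ltr0n.
have im : (i %/ m n < M n)%N by rewrite ltn_divLR.
have iE : i%:R = (i %/ m n)%:R * (m n)%:R + (i %% m n)%:R :> R.
  by rewrite -natrM -natrD -divn_eq.
have r0 : 0 <= (i %% m n)%:R :> R by [].
have r1 : (i %% m n)%:R + 1 <= (m n)%:R :> R.
  by rewrite natr1 ler_nat ltn_pmod.
move: it; rewrite ler_pdivrMr ?mulr_gt0 // ltr_pdivlMr ?mulr_gt0 // iE => /andP[it1 it2].
rewrite (IH (i %/ m n)%N) //; last first.
  by rewrite ler_pdivrMr // ltr_pdivlMr //; apply/andP; split; nra.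
rewrite /shuffle1.
set s := t + _.
have sE : (M n * m n)%:R * s = (M n)%:R * (m n)%:R * t +
    (m n)%:R * ((cell_perm n (i %/ m n))%:R - (i %/ m n)%:R).
  by rewrite /s natrM; field; rewrite gt_eqF.
(* The image [s] lies in the cell of level [n] of index [cell_perm n (i %/ m n)],
   at the same relative position [i %% m n] among its subcells. *)
have -> : Num.truncn ((M n * m n)%:R * s) = (cell_perm n (i %/ m n) * m n + i %% m n)%N.
  apply/eqP; rewrite truncn_eq sE; last first.
    have : 0 <= (cell_perm n (i %/ m n))%:R * (m n)%:R :> R by rewrite mulr_ge0.
    by nra.
  by rewrite -natr1 natrD natrM; apply/andP; split; nra.
rewrite /shuffle_idx modnMDl modn_mod divnMDl // (divn_small (ltn_pmod i m0)) addn0.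
by rewrite /s !natrD !natrM; field; rewrite !gt_eqF.
Qed.

Section rV.
Context {d : nat}.

Lemma floor_subcube n (b : 'I_d -> nat) (y' : 'rV[R]_d) :
  subcube p n (\row_i (b i)%:R) y' ->
  floor_rV ((M n)%:R *: y') = \row_i (b i)%:R.
Proof.
move=> by'; apply/rowP => i; rewrite !mxE.
have M0 : 0 < (M n)%:R :> R by rewrite ltr0n period_ratio_gt0.
have := by' i; rewrite mxE ler_pdivrMr // ltr_pdivlMr // => /andP[y1 y2].
rewrite -[RHS]/((Posz (b i))%:~R); congr (_%:~R); apply/eqP.
by rewrite floor_eq mulrC y1 intrD /= y2.
Qed.

Lemma subcube_ex n (y' : 'rV[R]_d) : cube_co 1 y' ->
  exists b : 'I_d -> 'I_(M n), subcube p n (\row_i (b i)%:R) y'.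
Proof.
move=> y'1; have M0 : 0 < (M n)%:R :> R by rewrite ltr0n period_ratio_gt0.
have bM i : (Num.truncn ((M n)%:R * y' ord0 i) < M n)%N.
  have /andP[y0 y1] := y'1 i.
  by rewrite truncn_lt_nat ?mulr_ge0 // gtr_pMr.
exists (fun i => Ordinal (bM i)) => i; rewrite mxE /=.
have /andP[y0 y1] := y'1 i.
rewrite ler_pdivrMr // ltr_pdivlMr // mulrC natr1 truncnS_gt andbT.
by rewrite truncn_le mulr_ge0 // ltW.
Qed.

Lemma subcube_sub_cube n (b : 'I_d -> nat) : (forall i, b i < M n)%N ->
  subcube p n (\row_i (b i)%:R) `<=` cube_co 1.
Proof.
move=> bM y' by' i; have M0 : 0 < (M n)%:R :> R by rewrite ltr0n period_ratio_gt0.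
have := by' i; rewrite mxE => /andP[y1 y2].
rewrite (le_trans _ y1) ?divr_ge0 // (lt_le_trans y2) //.
by rewrite ler_pdivrMr // mul1r natr1 ler_nat.
Qed.

Lemma shuffle_rVE n (b : 'I_d -> nat) (y' : 'rV[R]_d) : (forall i, b i < M n)%N ->
  subcube p n (\row_i (b i)%:R) y' ->
  shuffle_rV p n y' =
  y' + \row_i (((cell_perm n (b i))%:R - (b i)%:R) / (M n)%:R).
Proof.
move=> bM by'; apply/rowP => i; rewrite !mxE (@shuffleE n (b i)) //.
by have := by' i; rewrite mxE.
Qed.

Lemma subcube_shuffle_rV n (b : 'I_d -> nat) (y' : 'rV[R]_d) :
  (forall i, b i < M n)%N -> subcube p n (\row_i (b i)%:R) y' ->
  subcube p n (\row_i (cell_perm n (b i))%:R) (shuffle_rV p n y').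
Proof.
move=> bM by' i; rewrite (shuffle_rVE bM by') !mxE.
have := by' i; rewrite mxE !mulrDl mulNr => /andP[y1 y2]; apply/andP; split; lra.
Qed.

(** On each cell of level [n], the shuffled function does not depend on its
    third argument. *)
Lemma shuffled_cell n (b : 'I_d -> nat) u0 x y (y' : 'rV[R]_d) :
  (forall i, b i < M n)%N -> subcube p n (\row_i (b i)%:R) y' ->
  shuffled p u0 n x y y' = u0 n x (y + p 0%N *: \row_i (cell_perm n (b i))%:R).
Proof.
move=> bM by'; rewrite /shuffled /rearr (@floor_subcube n (fun i => cell_perm n (b i))) //.
exact: subcube_shuffle_rV.
Qed.

Lemma shuffle_rV_bij n : set_bij (cube_co 1) (cube_co 1) (@shuffle_rV R d p n).
Proof.
split.
- move=> y' /(subcube_ex n)[b by'].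
  have := subcube_shuffle_rV (fun i => ltn_ord (b i)) by'.
  by apply: subcube_sub_cube => i; exact/cell_perm_lt.
- move=> y z; rewrite !inE => /(subcube_ex n)[b yb] /(subcube_ex n)[c zc] yz.
  have bM i := ltn_ord (b i); have cM i := ltn_ord (c i).
  have bc i : b i = c i :> nat.
    apply: (@cell_perm_inj n) => //; apply/eqP; rewrite -(eqr_nat R); apply/eqP.
    have := floor_subcube (subcube_shuffle_rV cM zc).
    rewrite -yz (floor_subcube (subcube_shuffle_rV bM yb)).
    by move=> /rowP/(_ i); rewrite !mxE.
  move: yz; rewrite (shuffle_rVE bM yb) (shuffle_rVE cM zc).
  rewrite [X in _ = _ + X](_ : _ =
    \row_i (((cell_perm n (b i))%:R - (b i)%:R) / (M n)%:R)); first by move=> /addIr.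
  by apply/rowP => i; rewrite !mxE bc.
- move=> z z1; have [c zc] := subcube_ex n z1.
  have /choice[b bc] : forall i, exists b, (b < M n)%N /\ cell_perm n b = c i.
    by move=> i; have [b bM bc] := cell_perm_surj (ltn_ord (c i)); exists b.
  have bM i : (b i < M n)%N by have [] := bc i.
  pose y := z + \row_i (((b i)%:R - (cell_perm n (b i))%:R) / (M n)%:R).
  have yb : subcube p n (\row_i (b i)%:R) y.
    move=> i; have := zc i; rewrite !mxE; have [_ <-] := bc i; rewrite !mulrDl mulNr.
    by move=> /andP[z1' z2]; apply/andP; split; lra.
  exists y; first exact: subcube_sub_cube yb.
  rewrite (shuffle_rVE bM yb); apply/rowP => i; rewrite !mxE.
  by ring.
Qed.

Lemma rearr_shuffled n u0 x y (y' : 'rV[R]_d) : cube_co 1 y' ->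
  rearr p u0 n x y y' =
  shuffled p u0 n x y (pinv (cube_co 1) (@shuffle_rV R d p n) y').
Proof.
move=> y'1; rewrite /shuffled; congr rearr; apply/esym.
have [_ _ surj] := shuffle_rV_bij n.
exact: (surjpK _ surj (mem_set y'1)).
Qed.

Lemma rearr_subcube n (u0 : nat -> 'rV[R]_d -> 'rV[R]_d -> R) x y :
  cube_co (p n) y ->
  let b := floor_rV ((p 0%N)^-1 *: y) in
  rearr p u0 n x (y - p 0%N *: b) @` subcube p n b = [set u0 n x y].
Proof.
move=> yp b.
have p0 := p_gt0 0%N.
pose c i := `|Num.floor (y ord0 i / p 0%N)|%N.
have bE : b = \row_i (c i)%:R.
  apply/rowP => i; rewrite !mxE mulrC /c; have /andP[y0 _] := yp i.
  by rewrite -[RHS]/((Posz _)%:~R) gez0_abs // floor_ge0 divr_ge0 // ltW.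
have M0 : 0 < (M n)%:R :> R by rewrite ltr0n period_ratio_gt0.
apply/seteqP; split => [_ [y' by' <-]|_ ->] /=.
  rewrite /rearr (@floor_subcube n c); last by rewrite -bE.
  by rewrite -bE subrK.
exists ((M n)%:R^-1 *: b).
  move=> i; rewrite !mxE [(M n)%:R^-1 * _]mulrC lexx /=.
  by rewrite ltr_pM2r ?invr_gt0 // ltrDl.
rewrite /rearr (@floor_subcube n c) -?bE ?subrK // => i.
by rewrite bE !mxE [(M n)%:R^-1 * _]mulrC lexx /= ltr_pM2r ?invr_gt0 // ltrDl.
Qed.

End rV.
End shuffle_cells.

(** * Integrals vanishing on a pi-system of sets *)

Section integral_lemmas.
Context {disp : measure_display} {T : measurableType disp} {R : realType}.
Variable mu : {measure set T -> \bar R}.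

(** Monotonicity of the integral of nonnegative functions holds without any
    measurability assumption. *)
Lemma ge0_le_integral_nomeas (D : set T) (f g : T -> \bar R) :
  (forall x, D x -> 0 <= f x)%E -> (forall x, D x -> f x <= g x)%E ->
  (\int[mu]_(x in D) f x <= \int[mu]_(x in D) g x)%E.
Proof.
move=> f0 fg; rewrite integral_mkcond [leRHS]integral_mkcond.
have fD0 x : (0 <= (f \_ D) x)%E by rewrite patchE; case: ifPn => // /set_mem /f0.
have fgD x : ((f \_ D) x <= (g \_ D) x)%E.
  by rewrite !patchE; case: ifPn => // /set_mem /fg.
rewrite !ge0_integralTE // => [|x]; last exact: le_trans (fgD x).
apply: ereal_sup_le => _ [h hf <-]; exists h => // x.
exact: le_trans (fgD x).
Qed.

(** The positive and the negative parts of [f] are the densities of two finite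
    measures that agree on the pi-system [G]. *)
Lemma integrable_pi_system_ae0 (G : set (set T)) (f : T -> \bar R) :
  measurable = <<s G >> -> setI_closed G -> G setT ->
  mu.-integrable setT f -> (forall A, G A -> \int[mu]_(x in A) f x = 0)%E ->
  ae_eq mu setT f (cst 0%E).
Proof.
move=> mG IG GT fi f0.
have mf : measurable_fun setT f := measurable_int _ fi.
have mk (g : T -> \bar R) : measurable_fun setT g -> (forall x, 0 <= g x)%E ->
    exists m : {measure set T -> \bar R}, forall A, m A = (\int[mu]_(x in A) g x)%E.
  move=> mg g0; pose m A := (\int[mu]_(x in A) g x)%E.
  have m0 : m set0 = 0%E by rewrite /m integral_set0.
  have mge0 A : (0 <= m A)%E by apply: integral_ge0.
  have msa : semi_sigma_additive m by exact: semi_sigma_additive_nng_induced.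
  pose mixin := isMeasure.Build _ _ _ m m0 mge0 msa.
  pose mm : {measure set T -> \bar R} := HB.pack m mixin.
  by exists mm.
have [m1 m1E] := mk _ (measurable_funepos mf) (fun=> funepos_ge0 _ _).
have [m2 m2E] := mk _ (measurable_funeneg mf) (fun=> funeneg_ge0 _ _).
have posT : (\int[mu]_x f^\+ x < +oo)%E by exact: integral_funepos_lt_pinfty.
have negT : (\int[mu]_x f^\- x < +oo)%E by exact: integral_funeneg_lt_pinfty.
have m12 A : G A -> m1 A = m2 A.
  move=> GA; have mA : measurable A by rewrite mG; exact: sub_sigma_algebra.
  rewrite m1E m2E.
  have := f0 _ GA; rewrite integralE => /eqP.
  rewrite sube_eq ?add0e; last first.
  - by rewrite fin_num_adde_defr.
  - rewrite ge0_fin_numE ?integral_ge0 //.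
    apply: integral_funepos_lt_pinfty => //; exact: integrableS fi.
  by move/eqP.
apply: (@integral_ae_eq _ _ _ mu) => // E _ mE.
rewrite integral0 integralE.
have : m1 E = m2 E.
  apply: (measure_unique G (fun=> setT)) => //.
  - by rewrite bigcup_const //; exists 0%N.
  - by move=> _; rewrite m1E.
rewrite m1E m2E => ->.
rewrite subee // ge0_fin_numE ?integral_ge0 //.
by apply: integral_funeneg_lt_pinfty => //; exact: integrableS fi.
Qed.

End integral_lemmas.

Lemma measurable_prod_gen {d1 d2} {T1 : measurableType d1} {T2 : measurableType d2}
    (G : set (set T2)) : measurable = <<s G >> -> G setT ->
  (measurable : set (set (T1 * T2))) =
  <<s [set AB | exists A B, [/\ measurable A, G B & AB = A `*` B]] >>.
Proof.
move=> mG GT; rewrite measurable_prod_measurableType.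
set H := [set AB | _].
have GH B : G B -> measurable B by rewrite mG; exact: sub_sigma_algebra.
apply/seteqP; split; last first.
  apply: smallest_sub; first exact: smallest_sigma_algebra.
  move=> _ [A [B [mA GB ->]]]; apply: sub_sigma_algebra; exists A => //.
  by exists B => //; exact: GH.
apply: smallest_sub; first exact: smallest_sigma_algebra.
move=> _ [A mA [B mB <-]].
pose K := [set B : set T2 | <<s H >> (A `*` B)].
suff: <<s G >> `<=` K by apply; rewrite -mG.
have sH := smallest_sigma_algebra setT H.
have KT : K setT by apply: sub_sigma_algebra; exists A, setT.
apply: smallest_sub => [|C GC]; last by apply: sub_sigma_algebra; exists A, C.
split=> [|C KC|F KF].
- by rewrite /K /= setX0; exact: sigma_algebra0.
- rewrite /K /= (_ : A `*` _ = (A `*` setT) `\` (A `*` C)).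
    exact: (@measurableD _ (g_sigma_algebraType H)).
  apply/seteqP; split=> -[x y] /=; first by move=> [Ax [_ Cy]]; split=> // -[].
  by move=> [[Ax _] nC]; split => //; split => // Cy; apply: nC.
- rewrite /K /= setX_bigcupr.
  exact: sigma_algebra_bigcup.
Qed.

(** * Periodic test functions *)

Section cubes.
Context {R : realType} {d : nat}.

Lemma cube_ccE (q : R) : cube_cc q = box (fun=> `[0, q]%classic) :> set 'rV[R]_d.
Proof. by apply/seteqP; split => y /= H i; have := H i; rewrite /= in_itv. Qed.

Lemma cube_coE (q : R) : cube_co q = box (fun=> `[0, q[%classic) :> set 'rV[R]_d.
Proof. by apply/seteqP; split => y /= H i; have := H i; rewrite /= in_itv. Qed.

Lemma measurable_cube_cc (q : R) : measurable (cube_cc q : set 'rV[R]_d).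
Proof. by rewrite cube_ccE; apply: measurable_box => i; exact: measurable_itv. Qed.

Lemma measurable_cube_co (q : R) : measurable (cube_co q : set 'rV[R]_d).
Proof. by rewrite cube_coE; apply: measurable_box => i; exact: measurable_itv. Qed.

Lemma cube_co_sub_cc (q : R) : cube_co q `<=` (cube_cc q : set 'rV[R]_d).
Proof. by move=> y qy i; have /andP[-> /ltW ->] := qy i. Qed.

Lemma lebesgue_cube_cc_lt_pinfty (q : R) :
  (lebesgue_rV d (cube_cc q) < +oo)%E.
Proof.
rewrite cube_ccE; apply: lebesgue_box_lt_pinfty => i; first exact: measurable_itv.
by rewrite lebesgue_measure_itv; case: ifP => // _; rewrite -EFinB ltry.
Qed.

Lemma lebesgue_cube_co_cc (q : R) :
  lebesgue_rV d (cube_cc q `\` cube_co q) = 0%E.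
Proof.
have lt_pinfty := lebesgue_cube_cc_lt_pinfty q.
have eq_cube : lebesgue_rV d (cube_co q) = lebesgue_rV d (cube_cc q).
  rewrite cube_ccE cube_coE !lebesgue_rV_box => [|i|i]; try exact: measurable_itv.
  by apply: eq_bigr => i _; rewrite !lebesgue_measure_itv.
rewrite measureD //; [|exact: measurable_cube_cc|exact: measurable_cube_co].
rewrite setIidr; last exact: cube_co_sub_cc.
rewrite [X in (_ - X)%E]eq_cube subee // ge0_fin_numE //.
Qed.

End cubes.

Section bumps.
Context {R : realType}.

(** The functions [sin (pi t / q)] and [sin (pi (t - a) / q)] both change sign
    under [t |-> t + q]; their product is thus q-periodic, and on [0, q[ it is
    positive exactly beyond [a] when [a] lies in [0, q[. For the other values of
    [a] a constant function is enough. *)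
Lemma periodic_bump (q a : R) : 0 < q -> exists g : R -> R,
  [/\ continuous g, forall t, g (t + q) = g t, forall t, 0 <= g t &
      forall t, 0 <= t < q -> (0 < g t) = (a < t)].
Proof.
move=> q0.
have [a0|a0] := ltP a 0.
  exists (fun=> 1); split=> // [|t /andP[t0 _]]; first exact: cst_continuous.
  by rewrite ltr01 (lt_le_trans a0 t0).
have [aq|qa] := ltP a q; last first.
  exists (fun=> 0); split=> // [|t /andP[_ tq]]; first exact: cst_continuous.
  by rewrite ltxx ltNge (ltW (lt_le_trans tq qa)).
pose s (c t : R) := sin ((t - c) * (pi / q)).
have s_cont c : continuous (s c).
  move=> t; apply: (@continuous_comp _ _ _ (fun t => (t - c) * (pi / q)) sin).
    apply: continuousM; last exact: cst_continuous.
    by apply: continuousB => //; exact: cst_continuous.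
  exact: continuous_sin.
have s_anti c t : s c (t + q) = - s c t.
  rewrite /s (_ : _ * _ = (t - c) * (pi / q) + pi) ?sinDpi //.
  by field; rewrite gt_eqF.
have piq : 0 < pi / q :> R by rewrite divr_gt0 // pi_gt0.
have s_pos c t : c < t < c + q -> 0 < s c t.
  move=> /andP[ct tc]; apply: sin_gt0_pi; rewrite mulr_gt0 ?subr_gt0 //=.
  rewrite mulrA ltr_pdivrMr // mulrC ltr_pM2l ?pi_gt0 //.
  by rewrite ltrBlDl.
exists (fun t => Num.max (s 0 t * s a t) 0); split.
- move=> t; apply: (@continuous_max _ _ (fun t => s 0 t * s a t : R^o) (fun=> 0));
    last exact: cst_continuous.
  by apply: continuousM; exact: s_cont.
- by move=> t; rewrite !s_anti mulrNN.
- by move=> t; rewrite le_max lexx orbT.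
- move=> t /andP[t0 tq]; rewrite lt_max ltxx orbF.
  have [->|tn0] := eqVneq t 0.
    by rewrite {1}/s subrr mul0r sin0 mul0r ltxx ltNge a0.
  have {t0 tn0} t0 : 0 < t by rewrite lt_neqAle eq_sym tn0.
  rewrite pmulr_rgt0; last by apply: s_pos; rewrite t0 add0r tq.
  have [at_|] := ltP a t; first by rewrite s_pos // at_ (lt_le_trans tq) // lerDr.
  rewrite le_eqVlt => /predU1P[->|ta]; first by rewrite /s subrr mul0r sin0 ltxx.
  have : 0 < s a (t + q).
    by apply: s_pos; rewrite (lt_le_trans aq) ?lerDr ?(ltW t0) // ltrD2r.
  by rewrite s_anti oppr_gt0 => sN; rewrite ltNge (ltW sN).
Qed.

(** The open upper half-lines and the whole line: a pi-system generating the
    Borel sets of R, with the whole line added so that the boxes with such sides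
    generate the Borel sets of R^d. *)
Definition rays : set (set R) :=
  [set A | A = setT \/ exists a, A = `]a, +oo[%classic].

Lemma raysE : (measurable : set (set (measurableTypeR R))) = <<s rays >>.
Proof.
apply/seteqP; split.
  rewrite [X in X `<=` _](_ : _ = <<s @RGenOInfty.G R >>); last exact: RGenOInfty.measurableE.
  apply: smallest_sub; first exact: smallest_sigma_algebra.
  by move=> A [a ->]; apply: sub_sigma_algebra; right; exists a.
apply: smallest_sub; first exact: sigma_algebra_measurable.
move=> A [->|[a ->]]; first exact: measurableT.
exact: measurable_itv.
Qed.

Lemma raysI A B : rays A -> rays B -> rays (A `&` B).
Proof.
move=> [->|[a ->]]; first by rewrite setTI.
move=> [->|[b ->]]; first by rewrite setIT; right; exists a.
right; exists (Num.max a b); apply/seteqP; split => x /=; rewrite !in_itv /= !andbT gt_max.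
  by move=> [-> ->].
by move=> /andP[].
Qed.

Lemma periodic_ray_approx (q : R) (B : set R) : 0 < q -> rays B ->
  exists h : nat -> R -> R, [/\ forall k, continuous (h k),
    forall k t, h k (t + q) = h k t, forall k t, 0 <= h k t <= 1 &
    forall t, 0 <= t < q -> h k t @[k --> \oo] --> (\1_B t : R)].
Proof.
move=> q0 [->|[a ->]].
  exists (fun _ _ => 1); split=> [k|//|k t|t _]; first exact: cst_continuous.
    by rewrite ler01 lexx.
  by rewrite indicT; exact: cvg_cst.
have [g [gc gp g0 gB]] := periodic_bump a q0.
(* [min 1 (k g)] tends to the indicator of the set where [g] is positive. *)
exists (fun k t => Num.min 1 (k%:R * g t)); split=> [k t|k t|k t|t tq].
- apply: (@continuous_min _ _ (fun=> 1 : R^o) (fun t => k%:R * g t));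
    first exact: cst_continuous.
  by apply: continuousM; [exact: cst_continuous|exact: gc].
- by rewrite gp.
- by rewrite le_min ler01 mulr_ge0 //= ge_min lexx.
- rewrite indicE; have [tB|tB] := boolP (a < t).
    rewrite mem_set /=; last by rewrite in_itv /= tB.
    have gt0 : 0 < g t by rewrite gB.
    apply: cvg_near_cst; exists (Num.truncn (g t)^-1).+1 => // k /= kg.
    apply/min_idPl; rewrite -ler_pdivrMr // div1r.
    by rewrite ltW // (lt_le_trans (truncnS_gt _)) // ler_nat.
  rewrite memNset /=; last by rewrite in_itv /= andbT; exact/negP.
  have -> : g t = 0.
    by apply/eqP; rewrite eq_le g0 andbT leNgt gB.
  apply: cvg_near_cst; apply: nearW => k; rewrite mulr0.
  by apply/min_idPr.
Qed.

Lemma cvg_prodr (I : Type) (r : seq I) (f : I -> nat -> R) (l : I -> R) :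
  (forall i, f i k @[k --> \oo] --> l i) ->
  \prod_(i <- r) f i k @[k --> \oo] --> \prod_(i <- r) l i.
Proof.
move=> fl; elim: r => [|i r IH].
  by rewrite big_nil; under eq_cvg do rewrite big_nil; exact: cvg_cst.
by rewrite big_cons; under eq_cvg do rewrite big_cons; apply: cvgM.
Qed.

Lemma periodic_box_approx d (q : R) (B : 'I_d -> set R) : 0 < q ->
  (forall i, rays (B i)) ->
  exists h : nat -> 'rV[R]_d -> R, [/\ forall k, Cper q (h k),
    forall k y, 0 <= h k y <= 1 &
    forall y, cube_co q y -> h k y @[k --> \oo] --> (\1_(box B) y : R)].
Proof.
move=> q0 rB.
have /choice[h hP] i := periodic_ray_approx q0 (rB i).
exists (fun k y => \prod_i h i k (y ord0 i)); split=> [k|k y|y yq].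
- split.
  + apply: continuous_big => [|i _].
      by move=> x; apply: continuousM; [exact: cvg_fst|exact: cvg_snd].
    move=> y; apply: (@continuous_comp _ _ _ (fun y : 'rV[R]_d => y ord0 i)).
      exact: coord_continuous.
    by have [+ _ _ _] := hP i; exact.
  + move=> j y; apply: eq_bigr => i _; rewrite !mxE eqxx /=.
    case: (i == j); last by rewrite mulr0 addr0.
    by rewrite mulr1; have [_ + _ _] := hP i.
- apply/andP; split.
    by apply: prodr_ge0 => i _; have [_ _ + _] := hP i => /(_ k (y ord0 i))/andP[].
  by apply: prodr_ile1 => i _; have [_ _ + _] := hP i.
- rewrite (_ : \1_(box B) y = \prod_i \1_(B i) (y ord0 i)).
    by apply: cvg_prodr => i; have [_ _ _] := hP i; apply; exact: yq.
  rewrite indicE; have [yB|yB] := boolP (y \in box B).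
    by rewrite big1 // => i _; rewrite indicE mem_set //; have := set_mem yB; exact.
  have /existsNP[i nBi] : ~ forall i, B i (y ord0 i).
    by move=> H; move/negP: yB; apply; rewrite inE.
  by rewrite (bigD1 i) //= indicE memNset // mul0r.
Qed.

End bumps.

(** * Integration over products *)

Section product_integrals.
Context {R : realType}.

Lemma continuous_measurable_rV n (f : 'rV[R]_n -> R) :
  continuous f -> measurable_fun setT f.
Proof.
move=> cf; apply: (measurability _ (RGenOpens.measurableE R)) => //.
move=> _ [_ [x [y ->]] <-]; rewrite setTI; apply: open_measurable_rV.
by apply: open_comp => // z _; exact: cf.
Qed.

Lemma Rintegral_fubini {d1 d2} {T1 : measurableType d1} {T2 : measurableType d2}
    (m1 : {sigma_finite_measure set T1 -> \bar R})
    (m2 : {sigma_finite_measure set T2 -> \bar R})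
    (A : set T1) (B : set T2) (h : T1 -> T2 -> R) :
  (m1 \x m2)%E.-integrable setT (EFin \o ((fun z => h z.1 z.2) \_ (A `*` B))) ->
  \int[m1]_(x in A) \int[m2]_(y in B) h x y =
  \int[(m1 \x m2)%E]_z ((fun z => h z.1 z.2) \_ (A `*` B)) z.
Proof.
set f := EFin \o _ => fi.
have FE x : fubini_F m2 f x =
    if x \in A then (\int[m2]_(y in B) (h x y)%:E)%E else 0%E.
  rewrite /fubini_F; case: ifPn => xA.
    rewrite [RHS]integral_mkcond; apply: eq_integral => y _.
    rewrite /f /= !patchE in_setX /= xA /=; by case: ifP.
  apply: integral0_eq => y _; by rewrite /f /= patchE in_setX /= (negbTE xA).
rewrite /Rintegral; congr fine; rewrite -(integral12_prod_meas1 fi).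
rewrite integral_mkcond; apply: ae_eq_integral => //.
- have iF := integrable_fubini_F fi.
  rewrite (_ : _ \_ _ = EFin \o (fine \o fubini_F m2 f)).
    apply/measurable_EFinP; apply: measurableT_comp => //; exact: (measurable_fubini_F fi).
  by apply/funext => x /=; rewrite patchE FE; case: ifP.
- exact: (measurable_fubini_F fi).
have := integrable_ae measurableT (integrable_fubini_F fi).
apply: filterS => x /= /(_ I) fin _; rewrite patchE.
by move: fin; rewrite FE; case: ifP => // xA fin; rewrite fineK.
Qed.

Lemma L2_integrable {disp} {T : measurableType disp}
    (nu : {measure set T -> \bar R}) (D : set T) (f : T -> R) :
  measurable D -> (nu D < +oo)%E -> L2 nu D f ->
  nu.-integrable setT (EFin \o (f \_ D)).
Proof.
move=> mD Doo fL2.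
have mf : measurable_fun setT (f \_ D).
  by move: fL2; rewrite /L2 inE => /andP[]; rewrite inE.
have i1 : nu.-integrable setT (EFin \o (\1_D : T -> R)).
  apply/integrableP; split; first exact/measurable_EFinP/measurable_indic.
  rewrite (eq_integral (fun x => (\1_D x)%:E)); last first.
    by move=> t _; rewrite gee0_abs // lee_fin indicE.
  by rewrite integral_indic // setIT.
have i2 := Lfun2_integrable_sqr fL2.
apply: le_integrable (integrableD measurableT i1 i2) => //.
  exact/measurable_EFinP.
move=> x _ /=; rewrite lee_fin [leRHS]ger0_norm ?addr_ge0 ?sqr_ge0 //.
rewrite indicE patchE; case: (x \in D) => /=; last first.
  by rewrite (_ : point = 0 :> R) // normr0 expr0n addr0.
have le_sqr (a : R) : a <= 1 + a ^+ 2 by have := sqr_ge0 (a - 2^-1); nra.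
by rewrite -real_normK ?num_real.
Qed.

Section translation.
Context {d : nat}.
Local Notation mu := (@lebesgue_rV R d).
Local Notation nu := (mu \x mu)%E.

(** Translation of the second variable by [c]. *)
Definition translate2 (c : 'rV[R]_d) (z : 'rV[R]_d * 'rV[R]_d) := (z.1, z.2 + c).

Lemma measurable_translate2 c : measurable_fun setT (translate2 c).
Proof.
apply: measurable_fun_pair => //.
apply: (@measurableT_comp _ _ _ _ _ _ (fun y : 'rV[R]_d => y + c)) => //.
exact: measurable_translate.
Qed.

Lemma ae_translate2 (c : 'rV[R]_d) (P : 'rV[R]_d * 'rV[R]_d -> Prop) :
  {ae nu, forall z, P z} -> {ae nu, forall z, P (translate2 c z)}.
Proof.
move=> [N [mN N0 PN]]; exists (translate2 c @^-1` N); split.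
- by rewrite -[X in measurable X]setTI; exact: measurable_translate2.
- by rewrite prod_lebesgue_translate.
- by move=> z /= nP; exact: PN.
Qed.

Lemma ge0_integral_translate2 (c : 'rV[R]_d) (g : 'rV[R]_d * 'rV[R]_d -> \bar R) :
  measurable_fun setT g -> (forall z, 0 <= g z)%E ->
  (\int[nu]_z g (translate2 c z) = \int[nu]_z g z)%E.
Proof.
move=> mg g0; have mt := measurable_translate2 c.
transitivity (\int[pushforward nu (translate2 c)]_z g z)%E.
  by rewrite (ge0_integral_pushforward mt).
by apply: eq_measure_integral => A mA _; exact: prod_lebesgue_translate.
Qed.

Lemma integrable_translate2 (c : 'rV[R]_d) (g : 'rV[R]_d * 'rV[R]_d -> \bar R) :
  nu.-integrable setT g -> nu.-integrable setT (g \o translate2 c).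
Proof.
move=> /integrableP[mg goo]; apply/integrableP; split.
  by apply: measurableT_comp => //; exact: measurable_translate2.
rewrite (ge0_integral_translate2 c (g := fun z => `|g z|%E)) //.
exact: measurableT_comp.
Qed.

Lemma integral_translate2 (c : 'rV[R]_d) (g : 'rV[R]_d * 'rV[R]_d -> \bar R) :
  nu.-integrable setT g ->
  (\int[nu]_z g (translate2 c z) = \int[nu]_z g z)%E.
Proof.
move=> gi; have mt := measurable_translate2 c; have mg := measurable_int _ gi.
transitivity (\int[pushforward nu (translate2 c)]_z g z)%E.
  rewrite (integral_pushforward mt) //.
  by rewrite preimage_setT; exact: integrable_translate2.
by apply: eq_measure_integral => A mA _; exact: prod_lebesgue_translate.
Qed.

(** An integrable function carried by the period cell [cube_co q] in its second
    variable is determined by its integrals against q-periodic functions. *)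
Lemma periodic_test_ae0 (q : R) (f : 'rV[R]_d * 'rV[R]_d -> R) : 0 < q ->
  nu.-integrable setT (EFin \o f) ->
  (forall z, ~ cube_co q z.2 -> f z = 0) ->
  (forall A phi, measurable A -> Cper q phi -> (forall y, 0 <= phi y <= 1) ->
    (\int[nu]_z (f z * \1_A z.1 * phi z.2)%:E = 0)%E) ->
  {ae nu, forall z, f z = 0}.
Proof.
move=> q0 fi f0 ftest.
pose G := [set box A | A in [set A : 'I_d -> set R | forall i, rays (A i)]].
have mf : measurable_fun setT f by apply/measurable_EFinP; exact: measurable_int fi.
have raysT : rays (setT : set R) by left.
have mG : measurable = <<s G >> by apply: measurable_rV_gen => //; exact: raysE.
have GT : G setT by exists (fun=> setT) => //; apply/seteqP; split.
have mH := measurable_prod_gen (T1 := 'rV[R]_d) mG GT.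
suff : ae_eq nu setT (EFin \o f) (cst 0%E).
  by apply: filterS => z /= /(_ I) [].
apply: (integrable_pi_system_ae0 mH) => //.
- move=> _ _ [A [_ [mA [B rB <-] ->]]] [A' [_ [mA' [B' rB' <-] ->]]].
  exists (A `&` A'), (box (fun i => B i `&` B' i)); split.
  + exact: measurableI.
  + by exists (fun i => B i `&` B' i) => // i; apply: raysI.
  + by rewrite -boxI setXI.
- by exists setT, setT; split=> //; rewrite setXTT.
move=> _ [A [_ [mA [B rB <-] ->]]].
have [h [hC h01 hB]] := periodic_box_approx q0 rB.
have mB : measurable (box B).
  by rewrite mG; apply: sub_sigma_algebra; exists B.
have mA1 : measurable_fun setT (fun z : 'rV[R]_d * 'rV[R]_d => f z * \1_A z.1).
  apply: measurable_funM => //.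
  by apply: (@measurableT_comp _ _ _ _ _ _ (\1_A : _ -> R)) => //; exact: measurable_indic.
have := @dominated_convergence _ _ _ nu setT measurableT
  (fun k z => (f z * \1_A z.1 * h k z.2)%:E)
  (fun z => (f z * \1_A z.1 * \1_(box B) z.2)%:E)
  (fun z => `|(f z)%:E|%E).
case.
- move=> k; apply/measurable_EFinP; apply: measurable_funM => //.
  apply: (@measurableT_comp _ _ _ _ _ _ (h k)) => //.
  by apply: continuous_measurable_rV; have [] := hC k.
- apply/measurable_EFinP; apply: measurable_funM => //.
  by apply: (@measurableT_comp _ _ _ _ _ _ (\1_(box B) : _ -> R)) => //; exact: measurable_indic.
(* Off the period cell the approximation may fail, but there [f] vanishes. *)
- apply: aeW => z _; have [zq|zq] := pselect (cube_co q z.2).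
    apply: cvg_EFin; first exact: nearW.
    by apply: cvgM; [exact: cvg_cst|exact: hB].
  rewrite f0 // !mul0r; apply: cvg_near_cst; apply: nearW => k.
  by rewrite mul0r.
- exact: integrable_abse.
- apply: aeW => z k _; rewrite lee_fin !normrM -mulrA ler_piMr //.
  have /andP[h0 h1] := h01 k z.2.
  rewrite mulr_ile1 // [X in X <= _]ger0_norm ?indicE //.
  by case: (_ \in _).
move=> _ _ L.
have : (\int[nu]_z (f z * \1_A z.1 * \1_(box B) z.2)%:E = 0)%E.
  apply: (cvg_unique _ L) => //.
  rewrite (_ : (fun n => _) = fun=> 0%E); first exact: cvg_cst.
  by apply/funext => k; exact: ftest.
rewrite integral_mkcond => <-; apply: eq_integral => z _.
rewrite patchE in_setX !indicE; case: (_ \in A); case: (_ \in box B);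
  by rewrite /= ?(mulr1, mulr0).
Qed.

End translation.
End product_integrals.

(** * Averaging over a coarser period *)

Section averaging.
Context {R : realType} {d : nat}.
Local Notation mu := (@lebesgue_rV R d).
Local Notation nu := (mu \x mu)%E.

(** Such a product is itself simple, so the constant sequence approximates it. *)
Lemma L2_Cper_indic (Omega A : set 'rV[R]_d) (q : R) (phi : 'rV[R]_d -> R) :
  measurable Omega -> (mu Omega < +oo)%E -> measurable A -> Cper q phi ->
  L2_Cper Omega q (fun x y => \1_A x * phi y).
Proof.
move=> mO Ooo mA [phic phip].
pose F (b : bool) := (fun y => b%:R * phi y) : 'rV[R]_d -> R.
have FE x : (fun y => \1_A x * phi y) = F (x \in A).
  by apply/funext => y; rewrite indicE.
have CF b : Cper q (F b).
  split=> [y|i y]; last by rewrite /F phip.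
  by apply: (@continuousM _ _ (fun=> b%:R) phi); [exact: cst_continuous|exact: phic].
split.
- by move=> x _; rewrite FE; exact: CF.
- exists (fun _ x y => \1_A x * phi y); split.
    move=> _; split.
    + by move=> x _; rewrite FE; exact: CF.
    + apply: (@sub_finite_set _ _ (F @` [set: bool])).
        by move=> _ [x _ <-]; rewrite FE; exists (x \in A).
      exact: finite_image.
    + move=> g.
      rewrite (_ : _ @^-1` _ = (A `&` [set x | F true = g]) `|`
                               (~` A `&` [set x | F false = g])).
        apply: measurableI => //; apply: measurableU; apply: measurableI => //.
        * have [Fg|Fg] := pselect (F true = g).
            by rewrite (_ : mkset _ = setT) //; apply/seteqP; split.
          by rewrite (_ : mkset _ = set0) //; apply/seteqP; split.
        * exact: measurableC.
        * have [Fg|Fg] := pselect (F false = g).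
            by rewrite (_ : mkset _ = setT) //; apply/seteqP; split.
          by rewrite (_ : mkset _ = set0) //; apply/seteqP; split.
      apply/seteqP; split => x /=; rewrite FE.
        have [xA|xA] := boolP (x \in A) => Fg; [left|right]; split => //.
          exact: set_mem.
        by move=> Ax; move/negP: xA; apply; exact: mem_set.
      by move=> [[xA]|[xA]]; [rewrite mem_set|rewrite memNset].
  apply: aeW => x _.
  rewrite (_ : (fun j => _) = fun=> 0); first exact: cvg_cst.
  apply/funext => j; rewrite /supnorm.
  rewrite [X in sup X](_ : _ = [set 0]) ?sup1 //.
  apply/seteqP; split => [_ [y _ <-]|_ ->] /=; first by rewrite subrr normr0.
  by exists 0 => //; rewrite subrr normr0.
- pose K := Num.max (supnorm (F true) ^+ 2) (supnorm (F false) ^+ 2).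
  apply: (@le_lt_trans _ _ (\int[mu]_(x in Omega) K%:E)%E).
    apply: ge0_le_integral_nomeas => x _; first by rewrite lee_fin sqr_ge0.
    by rewrite lee_fin FE /K le_max; case: (_ \in _); rewrite lexx ?orbT.
  by rewrite integral_cst // lte_mul_pinfty // lee_fin /K le_max sqr_ge0.
Qed.

Lemma Cper_muln (q : R) (m : nat) (phi : 'rV[R]_d -> R) :
  Cper q phi -> Cper (m%:R * q) phi.
Proof.
move=> [phic phip]; split => // i y.
elim: m => [|m IH]; first by rewrite mul0r scale0r addr0.
by rewrite -natr1 mulrDl mul1r scalerDl addrA phip.
Qed.

Lemma Cper_translate (q : R) (phi : 'rV[R]_d -> R) (j : 'I_d -> nat) y :
  Cper q phi -> phi (y + \row_i ((j i)%:R * q)) = phi y.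
Proof.
move=> phiC.
have -> : \row_i ((j i)%:R * q) = \sum_i ((j i)%:R * q) *: delta_mx ord0 i :> 'rV[R]_d.
  apply/rowP => k; rewrite summxE (bigD1 k) //= !mxE !eqxx mulr1 big1 ?addr0 // => i ik.
  by rewrite !mxE eqxx /= eq_sym (negbTE ik) mulr0.
elim/big_rec : _ => [|i v _ IH]; first by rewrite addr0.
have [_ per] := Cper_muln (j i) phiC.
by rewrite [_ + v]addrC addrA per.
Qed.

(** The cube of side [m q] is tiled by [m ^ d] half-open cubes of side [q]. *)
Lemma cube_co_tiling (q : R) (m : nat) (y : 'rV[R]_d) : 0 < q -> (0 < m)%N ->
  \sum_(j : {ffun 'I_d -> 'I_m}) \1_(cube_co q) (y - \row_i ((j i)%:R * q)) =
  \1_(cube_co (m%:R * q)) y :> R.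
Proof.
move=> q0 m0.
have inE_cell (j : {ffun 'I_d -> 'I_m}) : cube_co q (y - \row_i ((j i)%:R * q)) <->
    forall i, (j i)%:R * q <= y ord0 i < ((j i).+1)%:R * q.
  split=> H i; have := H i; rewrite !mxE subr_ge0 ltrBlDr -natr1 mulrDl mul1r.
    by rewrite [X in _ < X]addrC.
  by rewrite [X in _ < X]addrC.
have [yq|yq] := pselect (cube_co (m%:R * q) y); last first.
  rewrite indicE memNset // big1 // => j _; rewrite indicE memNset //.
  move=> /inE_cell jy; apply: yq => i; have /andP[y1 y2] := jy i.
  rewrite (le_trans _ y1) ?mulr_ge0 ?(ltW q0) //= (lt_le_trans y2) //.
  by rewrite ler_pM2r // ler_nat.
rewrite [RHS]indicE mem_set //.
have lt_m i : (Num.truncn (y ord0 i / q) < m)%N.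
  have /andP[y1 y2] := yq i.
  by rewrite truncn_lt_nat ?divr_ge0 ?(ltW q0) // ltr_pdivrMr.
pose j0 : {ffun 'I_d -> 'I_m} := [ffun i => Ordinal (lt_m i)].
rewrite (bigD1 j0) //= indicE mem_set; last first.
  apply/inE_cell => i; rewrite ffunE /=; have /andP[y1 y2] := yq i.
  rewrite -ler_pdivlMr // -ltr_pdivrMr // truncnS_gt andbT truncn_le.
  by rewrite divr_ge0 // ltW.
rewrite big1 ?addr0 // => j jj0; rewrite indicE memNset //.
move=> /inE_cell jy; move/eqP: jj0; apply; apply/ffunP => i; apply/val_inj.
rewrite ffunE /=; apply/esym/eqP; rewrite truncn_eq.
  by rewrite ler_pdivlMr // ltr_pdivrMr.
by have /andP[y1 y2] := yq i; rewrite divr_ge0 // ltW.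
Qed.

Section two_scale.
Variable Omega : set 'rV[R]_d.
Hypotheses (mO : measurable Omega) (Ooo : (mu Omega < +oo)%E).

(** The restriction of [u0] to [Omega] times the half-open period cell. The
    half-open cells tile space, while the closed ones overlap on null sets. *)
Let cell_fun (q : R) (u0 : 'rV[R]_d -> 'rV[R]_d -> R) :=
  (fun z => u0 z.1 z.2) \_ (Omega `*` cube_co q).

Lemma integrable_cell_cc (q : R) (u0 : 'rV[R]_d -> 'rV[R]_d -> R) :
  L2 nu (Omega `*` cube_cc q) (fun z => u0 z.1 z.2) ->
  nu.-integrable setT (EFin \o ((fun z => u0 z.1 z.2) \_ (Omega `*` cube_cc q))).
Proof.
move=> uL2; apply: L2_integrable => //.
  by apply: measurableX => //; exact: measurable_cube_cc.
rewrite /= product_measure1E //; last exact: measurable_cube_cc.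
by rewrite lte_mul_pinfty // ?ge0_fin_numE // lebesgue_cube_cc_lt_pinfty.
Qed.

Lemma integrable_cell (q : R) (u0 : 'rV[R]_d -> 'rV[R]_d -> R) :
  L2 nu (Omega `*` cube_cc q) (fun z => u0 z.1 z.2) ->
  nu.-integrable setT (EFin \o cell_fun q u0).
Proof.
move=> /integrable_cell_cc ui.
have mco : measurable (Omega `*` cube_co q : set ('rV[R]_d * 'rV[R]_d)).
  by apply: measurableX => //; exact: measurable_cube_co.
have := integrableS measurableT mco (@subsetT _ _) ui.
move=> /(integrable_mkcond _ mco); apply: eq_integrable => // z _.
rewrite /= /cell_fun !patchE; case: ifPn => // /set_mem[zO zq].
rewrite /= patchE mem_set //; split => //; exact: cube_co_sub_cc.
Qed.

Lemma ae_cube_co (q : R) :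
  {ae nu, forall z, (Omega `*` cube_cc q) z -> cube_co q z.2}.
Proof.
exists (Omega `*` (cube_cc q `\` cube_co q)); split.
- apply: measurableX => //; apply: measurableD; first exact: measurable_cube_cc.
  exact: measurable_cube_co.
- rewrite /= product_measure1E //.
    by rewrite lebesgue_cube_co_cc mule0.
  apply: measurableD; first exact: measurable_cube_cc.
  exact: measurable_cube_co.
- by move=> z /= /not_implyP[[zO zq] nzq].
Qed.

Lemma integrable_mul_le1 (g h : 'rV[R]_d * 'rV[R]_d -> R) :
  nu.-integrable setT (EFin \o g) -> measurable_fun setT h ->
  (forall z, `|h z| <= 1) -> nu.-integrable setT (EFin \o (fun z => g z * h z)).
Proof.
move=> gi mh h1; have mg : measurable_fun setT g.
  by apply/measurable_EFinP; exact: measurable_int gi.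
apply: le_integrable gi => //.
  by apply/measurable_EFinP; exact: measurable_funM.
by move=> z _; rewrite lee_fin normrM ler_piMr.
Qed.

Section test.
Variables (A : set 'rV[R]_d) (phi : 'rV[R]_d -> R) (q : R).
Hypotheses (mA : measurable A) (phiC : Cper q phi).
Hypothesis phi01 : forall y, 0 <= phi y <= 1.

Let test (z : 'rV[R]_d * 'rV[R]_d) := \1_A z.1 * phi z.2 : R.

Let measurable_test : measurable_fun setT test.
Proof.
have [phic _] := phiC; apply: measurable_funM.
  by apply: (@measurableT_comp _ _ _ _ _ _ (\1_A : _ -> R)) => //; exact: measurable_indic.
by apply: (@measurableT_comp _ _ _ _ _ _ phi) => //; exact: continuous_measurable_rV.
Qed.

Let test_le1 z : `|test z| <= 1.
Proof.
have /andP[h0 h1] := phi01 z.2.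
rewrite /test normrM mulr_ile1 // ?[X in X <= _]ger0_norm ?indicE //.
by case: (_ \in _).
Qed.

Lemma integrable_test (g : 'rV[R]_d * 'rV[R]_d -> R) :
  nu.-integrable setT (EFin \o g) ->
  nu.-integrable setT (EFin \o (fun z => g z * (\1_A z.1 * phi z.2))).
Proof. by move=> gi; apply: (integrable_mul_le1 (h := test)). Qed.

Lemma test_integralE (Q : R) (u0 : 'rV[R]_d -> 'rV[R]_d -> R) :
  L2 nu (Omega `*` cube_cc Q) (fun z => u0 z.1 z.2) ->
  \int[mu]_(x in Omega) (\int[mu]_(y in cube_cc Q) (u0 x y * (\1_A x * phi y))) =
  fine (\int[nu]_z (cell_fun Q u0 z * (\1_A z.1 * phi z.2))%:E)%E.
Proof.
move=> uL2.
have ui := integrable_cell_cc uL2.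
have restrE : (fun z => u0 z.1 z.2 * test z) \_ (Omega `*` cube_cc Q) =
    (fun z => ((fun z => u0 z.1 z.2) \_ (Omega `*` cube_cc Q)) z * test z).
  by apply/funext => z; rewrite !patchE; case: ifP => //; rewrite mul0r.
have uti := integrable_test ui.
rewrite (Rintegral_fubini (h := fun x y => u0 x y * (\1_A x * phi y))); last first.
  by rewrite [X in EFin \o X]restrE.
rewrite /Rintegral; congr fine; rewrite [X in integral _ _ (fun z => (X z)%:E)]restrE.
apply: ae_eq_integral => //.
- exact: measurable_int uti.
- exact: measurable_int (integrable_test (integrable_cell uL2)).
have := ae_cube_co Q; apply: filterS => z zQ _; congr EFin; congr (_ * _).
rewrite /cell_fun !patchE.
have [zcc|zcc] := pselect ((Omega `*` cube_cc Q) z).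
  rewrite mem_set // mem_set //; split; [by case: zcc|exact: zQ].
rewrite !memNset // => -[zO zco]; apply: zcc; split => //; exact: cube_co_sub_cc.
Qed.

End test.

Let shift (q : R) m (j : {ffun 'I_d -> 'I_m}) : 'rV[R]_d := \row_i ((j i)%:R * q).

(** A function with period [q] and one with period [m q] that are two-scale
    limits of the same sequence are related by averaging over the [m ^ d]
    translates of the small period cell: both have the same integrals against
    [q]-periodic test functions, which are also [m q]-periodic. *)
Lemma two_scale_average (q : R) (m : nat) eps u u0 U0 : 0 < q -> (0 < m)%N ->
  two_scale_cvg Omega q eps u u0 -> two_scale_cvg Omega (m%:R * q) eps u U0 ->
  {ae nu, forall z, (Omega `*` cube_co q) z -> u0 z.1 z.2 =
    (m%:R ^+ d)^-1 * \sum_(j : {ffun 'I_d -> 'I_m}) U0 z.1 (z.2 + \row_i ((j i)%:R * q))}.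
Proof.
move=> q0 m0 [_ uL2 u_cvg] [_ UL2 U_cvg].
have mR0 : 0 < m%:R :> R by rewrite ltr0n.
set Q := m%:R * q; pose F := cell_fun Q U0; pose f1 := cell_fun q u0.
have Fi : nu.-integrable setT (EFin \o F) := integrable_cell UL2.
have f1i : nu.-integrable setT (EFin \o f1) := integrable_cell uL2.
pose c := (m%:R ^+ d)^-1 : R.
(* [F] cut off to the translate of index [j] of the small cell. *)
pose G (j : {ffun 'I_d -> 'I_m}) z := F z * \1_(cube_co q) (z.2 - shift q j).
have Gi j : nu.-integrable setT (EFin \o G j).
  apply: integrable_mul_le1 => // [|z]; last first.
    by rewrite ger0_norm indicE //; case: (_ \in _).
  apply: (@measurableT_comp _ _ _ _ _ _ (\1_(cube_co q) : 'rV[R]_d -> R)).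
    by apply: measurable_indic; exact: measurable_cube_co.
  exact: (measurableT_comp measurable_snd (measurable_translate2 (- shift q j))).
have sumG z : \sum_j G j z = F z.
  rewrite /G -big_distrr /= cube_co_tiling // -/Q /F /cell_fun patchE indicE.
  case: ifPn => [|_]; last by rewrite mul0r.
  by move=> /set_mem[_ zQ]; rewrite mem_set ?mulr1.
pose H z := \sum_j G j (translate2 (shift q j) z).
have HE z : EFin (H z) = (\sum_j (EFin \o G j) (translate2 (shift q j) z))%E.
  by rewrite /H -sumEFin.
pose f z := f1 z - c * H z.
have Hi : nu.-integrable setT (EFin \o H).
  rewrite (_ : _ \o _ = fun z => \sum_j (EFin \o G j) (translate2 (shift q j) z))%E.
    by apply: integrable_sum => // j _; exact: integrable_translate2.
  by apply/funext => z; exact: HE.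
have cHi : nu.-integrable setT (EFin \o (fun z => c * H z)).
  exact: (integrableZl measurableT c Hi).
have fi : nu.-integrable setT (EFin \o f) by exact: (integrableB measurableT f1i cHi).
have f0 z : ~ cube_co q z.2 -> f z = 0.
  move=> zq; rewrite /f /f1 /cell_fun patchE memNset; last by case.
  rewrite /H big1 ?mulr0 ?subr0 // => j _.
  by rewrite /G /= addrK indicE memNset ?mulr0.
have ftest A phi : measurable A -> Cper q phi -> (forall y, 0 <= phi y <= 1) ->
    (\int[nu]_z (f z * \1_A z.1 * phi z.2)%:E = 0)%E.
  move=> mA phiC phi01.
  have ti := @integrable_test A phi q mA phiC phi01.
  pose I1 := (\int[nu]_z (f1 z * (\1_A z.1 * phi z.2))%:E)%E.
  pose I2 := (\int[nu]_z (F z * (\1_A z.1 * phi z.2))%:E)%E.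
  have I12 : fine I1 = c * fine I2.
    have C1 := u_cvg _ (L2_Cper_indic mO Ooo mA phiC).
    have C2 := U_cvg _ (L2_Cper_indic mO Ooo mA (Cper_muln m phiC)).
    (* Both right-hand sides are limits of the same sequence of integrals. *)
    have := cvg_unique (@Rhausdorff R) C1 C2.
    rewrite (test_integralE mA phiC phi01 uL2) (test_integralE mA phiC phi01 UL2).
    move=> eqI; have qd : q ^+ d != 0 by rewrite expf_neq0 // gt_eqF.
    have md : (m%:R : R) ^+ d != 0 by rewrite expf_neq0 // gt_eqF.
    apply: (mulfI (invr_neq0 qd)); rewrite [LHS]eqI /c.
    by rewrite [in LHS]exprMn; field; rewrite qd md.
  have HI : (\int[nu]_z (H z * (\1_A z.1 * phi z.2))%:E)%E = I2.
    transitivity (\sum_j \int[nu]_z (G j z * (\1_A z.1 * phi z.2))%:E)%E; last first.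
      rewrite -integral_sum => [|//|j]; last exact: ti.
      by apply: eq_integral => z _; rewrite sumEFin -big_distrl /= sumG.
    transitivity (\sum_j \int[nu]_z
       (EFin \o (fun z => (G j z * (\1_A z.1 * phi z.2))%R))
         (translate2 (shift q j) z))%E; last first.
      by apply: eq_bigr => j _; rewrite integral_translate2 //; exact: ti.
    rewrite -integral_sum => [|//|j]; last by apply: integrable_translate2; exact: ti.
    apply: eq_integral => z _; rewrite sumEFin /H big_distrl /=; congr EFin.
    by apply: eq_bigr => j _; rewrite (Cper_translate _ _ phiC).
  transitivity (I1 - c%:E * I2)%E.
    rewrite -HI -integralZl //; last exact: ti.
    rewrite -integralB //; [|exact: ti|by apply: integrableZl => //; exact: ti].
    by apply: eq_integral => z _; rewrite /f -EFinM -EFinB; congr EFin; ring.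
  have fin1 : I1 \is a fin_num by apply: integrable_fin_num => //; exact: ti.
  have fin2 : I2 \is a fin_num by apply: integrable_fin_num => //; exact: ti.
  by rewrite -(fineK fin1) -(fineK fin2) -EFinM -EFinB I12 subrr.
have := periodic_test_ae0 q0 fi f0 ftest.
apply: filterS => z fz [zO zq]; move: fz; rewrite /f /f1 /cell_fun patchE mem_set //.
move=> /eqP; rewrite subr_eq0 => /eqP ->; congr (_ * _); apply: eq_bigr => j _.
rewrite /G /= addrK indicE [_ \in cube_co q]mem_set // mulr1 /F /cell_fun patchE mem_set //.
split => // i; have /andP[y0 yq] := zq i; rewrite !mxE.
rewrite addr_ge0 ?mulr_ge0 ?(ltW q0) //=.
apply: (@lt_le_trans _ _ (q + (j i)%:R * q)); first by rewrite ltrD2r.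
by rewrite -{1}(mul1r q) -mulrDl ler_pM2r // addrC natr1 ler_nat.
Qed.

End two_scale.
End averaging.

(** * From convergence in L^2 to almost everywhere identities *)

Section L2_limits.
Context {disp : measure_display} {T : measurableType disp} {R : realType}.
Variable mu : {measure set T -> \bar R}.

(** The infimum of the [F k] for [N <= k] has integral zero, hence vanishes
    almost everywhere. No measurability of [g] is needed. *)
Lemma ae_eq0_of_le_cvg0 (F : nat -> T -> \bar R) (D : set T) (g : T -> \bar R) N :
  (forall k, measurable_fun setT (F k)) -> (forall k z, 0 <= F k z)%E ->
  (\int[mu]_z F k z @[k --> \oo] --> 0)%E ->
  {ae mu, forall z, D z -> forall k, (N <= k)%N -> (0 <= g z <= F k z)%E} ->
  {ae mu, forall z, D z -> g z = 0%E}.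
Proof.
move=> mF F0 F_cvg gF.
pose G z := einfs (F ^~ z) N.
have mG : measurable_fun setT G by exact: measurable_fun_einfs.
have G0 z : (0 <= G z)%E by apply: le_ereal_inf_tmp => _ [k _ <-].
have GF z k : (N <= k)%N -> (G z <= F k z)%E.
  by move=> Nk; apply: ereal_inf_lbound; exists k.
have intG : (\int[mu]_z G z = 0)%E.
  apply/eqP; rewrite eq_le integral_ge0 // andbT.
  apply: (cvge_ge _ F_cvg); exists N => // k /= Nk.
  by apply: ge0_le_integral_nomeas => z _ //; exact: GF.
have : ae_eq mu setT G (cst 0%E).
  apply/(ae_eq_integral_abs mu measurableT mG).
  by under eq_integral do rewrite gee0_abs //.
apply: filterS2 gF => z gF /(_ I) Gz Dz.
apply/eqP; rewrite eq_le; apply/andP; split; last by have /andP[] := gF Dz N (leqnn N).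
rewrite -[leRHS]Gz; apply: le_ereal_inf_tmp => _ [k Nk <-].
by have /andP[] := gF Dz k Nk.
Qed.

(** By the Cauchy-Schwarz inequality on [E]. The functions need not be measurable
    on the whole of [D]. *)
Lemma L1_cvg0_of_L2norm (D E : set T) (h : nat -> T -> R) :
  E `<=` D -> measurable E -> (mu E < +oo)%E ->
  (forall k, measurable_fun setT (h k \_ E)) ->
  L2norm mu D (h k) @[k --> \oo] --> 0%E ->
  (\int[mu]_z `|(h k \_ E) z|%:E @[k --> \oo] --> 0)%E.
Proof.
move=> ED mE Eoo mh h_cvg.
pose K := ('N[mu]_2%:E[EFin \o (\1_E : T -> R)])%E.
have K_fin : K \is a fin_num.
  rewrite ge0_fin_numE ?Lnorm_ge0 // /K unlock /=.
  apply: poweR_lty; rewrite (eq_integral (fun x => (\1_E x)%:E)).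
    by rewrite integral_indic // setIT.
  move=> x _; rewrite /= indicE; case: (x \in E) => /=.
    by rewrite normr1 powR1.
  by rewrite normr0 powR0 // pnatr_eq0.
have bound k : (\int[mu]_z `|(h k \_ E) z|%:E <= L2norm mu D (h k) * K)%E.
  apply: (@le_trans _ _ ('N[mu]_2%:E[EFin \o (h k \_ E)] * K)%E).
    have half : 2^-1 + 2^-1 = 1 :> R by lra.
    have m1 : measurable_fun setT (\1_E : T -> R) by exact: measurable_indic.
    have := @hoelder _ _ _ mu (h k \_ E) (\1_E) 2 2 (mh k) m1
      (ltr0n _ 2) (ltr0n _ 2) half.
    rewrite Lnorm1; apply: le_trans; apply: ge0_le_integral_nomeas => // z _.
    rewrite lee_fin /= indicE patchE; case: (z \in E); rewrite ?mulr1 //.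
    by rewrite (_ : point = 0 :> R) // normr0.
  apply: lee_wpmul2r; first exact: Lnorm_ge0.
  rewrite /L2norm unlock /=; apply: gt0_ler_poweR.
  - by rewrite invr_ge0.
  - by rewrite in_itv /= leey integral_ge0.
  - by rewrite in_itv /= leey integral_ge0.
  apply: ge0_le_integral_nomeas => z _ //; rewrite lee_fin.
  rewrite !patchE; have [zE|zE] := boolP (z \in E).
    by rewrite mem_set //; apply: ED; exact: set_mem.
  by rewrite (_ : point = 0 :> R) // normr0 powR0 ?powR_ge0 // pnatr_eq0.
apply: (@squeeze_cvge _ _ _ _ (fun=> 0%E) _ (fun k => L2norm mu D (h k) * K)%E).
- by apply: nearW => k; rewrite bound andbT integral_ge0.
- exact: cvg_cst.
- by rewrite -[X in _ --> X](mul0e K); exact: cvgeZr.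
Qed.

End L2_limits.

Section section_integrals.
Context {d1 d2 : measure_display} {T1 : measurableType d1} {T2 : measurableType d2}.
Context {R : realType}.
Variable m1 : {sigma_finite_measure set T1 -> \bar R}.
Variable m2 : {sigma_finite_measure set T2 -> \bar R}.

Lemma sigma_finite_prod : sigma_finite setT (m1 \x m2)%E.
Proof.
have /sigma_finiteP[F [TF ndF Foo]] := sigma_finiteT m1.
have /sigma_finiteP[G [TG ndG Goo]] := sigma_finiteT m2.
exists (fun k => F k `*` G k) => [|k].
  apply/seteqP; split => // -[x y] _.
  have [i _ Fx] : (\bigcup_k F k) x by rewrite -TF.
  have [j _ Gy] : (\bigcup_k G k) y by rewrite -TG.
  exists (maxn i j) => //; split.
    by move: x Fx; exact/subsetPset/ndF/leq_maxl.
  by move: y Gy; exact/subsetPset/ndG/leq_maxr.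
have [mF Fk] := Foo k; have [mG Gk] := Goo k; split; first exact: measurableX.
by rewrite product_measure1E // lte_mul_pinfty // ge0_fin_numE.
Qed.

(** The product of two sigma-finite measures, as a sigma-finite measure. *)
Definition sigma_finite_prod_measure :
    {sigma_finite_measure set (T1 * T2)%type -> \bar R} :=
  HB.pack_for {sigma_finite_measure set (T1 * T2)%type -> \bar R} (m1 \x m2)%E
    (Measure_isSigmaFinite.Build _ _ _ (m1 \x m2)%E sigma_finite_prod).

(** If [s k] tends to [w] in [L^1] of a product and the integral of [s k] along
    sections is eventually [v], then [v] is the integral of [w] along sections. *)
Lemma ae_section_integral_limit (s : nat -> T1 * T2 -> R) (w : T1 * T2 -> R)
    (S : set T1) (v : T1 -> R) N :
  (forall k, measurable_fun setT (s k)) ->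
  (forall k x, m2.-integrable setT (fun y => (s k (x, y))%:E)) ->
  (m1 \x m2)%E.-integrable setT (EFin \o w) ->
  (\int[m1 \x m2]_z `|s k z - w z|%:E @[k --> \oo] --> 0)%E ->
  {ae m1, forall x, S x -> forall k, (N <= k)%N ->
    (\int[m2]_y (s k (x, y))%:E = (v x)%:E)%E} ->
  {ae m1, forall x, S x -> v x = \int[m2]_y w (x, y)}.
Proof.
move=> ms si wi s_cvg sv.
pose H k (z : T1 * T2) := `|s k z - w z|%:E.
have mH k : measurable_fun setT (H k).
  apply/measurable_EFinP; apply: measurableT_comp => //; apply: measurable_funB => //.
  by apply/measurable_EFinP; exact: measurable_int wi.
have H0 k z : (0 <= H k z)%E by rewrite lee_fin.
pose F k := fubini_F m2 (H k).
have mF k : measurable_fun setT (F k) by exact: measurable_fun_fubini_tonelli_F.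
have F0 k x : (0 <= F k x)%E by apply: integral_ge0.
have F_cvg : (\int[m1]_x F k x @[k --> \oo] --> 0)%E.
  apply: cvg_trans s_cvg; apply: near_eq_cvg; apply: nearW => k.
  exact: (fubini_tonelli1 (H k) (mH k) (H0 k)).
pose err x := `|v x - \int[m2]_y w (x, y)|%:E.
have err_le : {ae m1, forall x, S x -> forall k, (N <= k)%N -> (0 <= err x <= F k x)%E}.
  apply: filterS2 sv (ae_integrable1 wi) => x svx wxi Sx k Nk.
  rewrite lee_fin normr_ge0 /=.
  have wxE : (\int[m2]_y (w (x, y))%:E)%E = (\int[m2]_y w (x, y))%:E.
    by rewrite /Rintegral fineK // integrable_fin_num.
  rewrite /err -abse_EFin EFinB -(svx Sx k Nk) -wxE -integralB //.
  apply: (@le_trans _ _ (\int[m2]_y `|(s k (x, y))%:E - (w (x, y))%:E|)%E).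
    by apply: le_abse_integral => //; apply: emeasurable_funB;
      [exact: measurable_int (si k x)|exact: measurable_int wxi].
  by apply: ge0_le_integral_nomeas.
apply: filterS (ae_eq0_of_le_cvg0 mF F0 F_cvg err_le) => x err0 Sx.
by have [/eqP] := err0 Sx; rewrite normr_eq0 subr_eq0 => /eqP.
Qed.

End section_integrals.

(** * Cell averages of the shuffled functions *)

Section cell_averages.
Context {R : realType} {d : nat}.
Local Notation mu := (@lebesgue_rV R d).
Local Notation nu := (mu \x mu)%E.
Variable p : nat -> R.
Hypothesis p_gt0 : forall n, 0 < p n.
Hypothesis p_mult : forall n, exists k : int, p n.+1 = k%:~R * p n.

Local Notation M := (period_ratio p).
Local Notation m := (step_ratio p).

Let M_gt0 n : 0 < (M n)%:R :> R.
Proof. by rewrite ltr0n; exact: period_ratio_gt0. Qed.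

Lemma period_ratio_dvd n k : (n <= k)%N -> (M n %| M k)%N.
Proof.
move=> /subnK <-; elim: (k - n)%N => [//|l IH].
by rewrite addSn period_ratioS // dvdn_mulr.
Qed.

Lemma subcube_boxE n (b : 'I_d -> nat) : subcube p n (\row_i (b i)%:R) =
  box (fun i => `[(b i)%:R / (M n)%:R, ((b i)%:R + 1) / (M n)%:R[%classic).
Proof. by apply/seteqP; split => y H i; have := H i; rewrite mxE /= in_itv. Qed.

Lemma measurable_subcube n (b : 'I_d -> nat) :
  measurable (subcube p n (\row_i (b i)%:R) : set 'rV[R]_d).
Proof. by rewrite subcube_boxE; apply: measurable_box => i; exact: measurable_itv. Qed.

Lemma lebesgue_subcube n (b : 'I_d -> nat) :
  mu (subcube p n (\row_i (b i)%:R)) = (((M n)%:R ^+ d)^-1)%:E.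
Proof.
rewrite subcube_boxE lebesgue_rV_box => [|i]; last exact: measurable_itv.
rewrite (eq_bigr (fun=> (((M n)%:R^-1)%:E : \bar R))) => [|i _].
  by rewrite prodEFin prodr_const card_ord exprVn.
rewrite lebesgue_measure_itv /= lte_fin ltr_pM2r ?invr_gt0 // ltrDl ltr01 -EFinB.
by rewrite -mulrBl addrAC subrr add0r mul1r.
Qed.

Lemma subcube_inj n (b c : 'I_d -> nat) (y : 'rV[R]_d) :
  subcube p n (\row_i (b i)%:R) y -> subcube p n (\row_i (c i)%:R) y ->
  forall i, b i = c i.
Proof.
move=> /(floor_subcube p_gt0 p_mult) by_ /(floor_subcube p_gt0 p_mult) + i.
rewrite by_ => /rowP/(_ i); rewrite !mxE => /eqP.
by rewrite eqr_nat => /eqP.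
Qed.

Lemma subcube_coarsen n k (g : 'I_d -> nat) (y : 'rV[R]_d) : (n <= k)%N ->
  subcube p k (\row_i (g i)%:R) y ->
  subcube p n (\row_i (g i %/ (M k %/ M n))%:R) y.
Proof.
move=> nk gy i; have := gy i; rewrite !mxE.
have Mdvd := period_ratio_dvd nk.
have Mn0 := M_gt0 n; set D := (M k %/ M n)%N.
have Mk0N := period_ratio_gt0 p_gt0 p_mult k.
have Mn0N := period_ratio_gt0 p_gt0 p_mult n.
have D0 : (0 < D)%N by rewrite divn_gt0 // dvdn_leq.
have DR0 : 0 < D%:R :> R by rewrite ltr0n.
have MkE : (M k)%:R = D%:R * (M n)%:R :> R by rewrite -natrM divnK.
have gE : (g i)%:R = (g i %/ D)%:R * D%:R + (g i %% D)%:R :> R.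
  by rewrite -natrM -natrD -divn_eq.
have r0 : 0 <= (g i %% D)%:R :> R by [].
have r1 : (g i %% D)%:R + 1 <= D%:R :> R by rewrite natr1 ler_nat ltn_pmod.
rewrite MkE ler_pdivrMr ?mulr_gt0 // ltr_pdivlMr ?mulr_gt0 // gE => /andP[y1 y2].
rewrite ler_pdivrMr // ltr_pdivlMr // -(ler_pM2r DR0) -[X in _ && X](ltr_pM2r DR0).
by apply/andP; split; nra.
Qed.

Variable u0 : nat -> 'rV[R]_d -> 'rV[R]_d -> R.

(** The value of the [n]-th shuffled function on the cell of index [b]. *)
Definition cell_value n (b : 'I_d -> nat) (z : 'rV[R]_d * 'rV[R]_d) : R :=
  u0 n z.1 (z.2 + p 0%N *: \row_i (cell_perm p n (b i))%:R).

Lemma cell_shift_cube n (b : 'I_d -> nat) (y : 'rV[R]_d) : (forall i, b i < M n)%N ->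
  cube_co (p 0%N) y ->
  cube_co (p n) (y + p 0%N *: \row_i (cell_perm p n (b i))%:R).
Proof.
move=> bM yp i; have /andP[y0 y1] := yp i; have p0 := p_gt0 0%N.
rewrite !mxE addr_ge0 ?mulr_ge0 ?(ltW p0) //= (period_ratioE p_gt0 p_mult n).
apply: (@lt_le_trans _ _ (p 0%N + p 0%N * (cell_perm p n (b i))%:R)).
  by rewrite ltrD2r.
rewrite -{1}(mulr1 (p 0%N)) -mulrDr mulrC ler_pM2r // addrC natr1 ler_nat.
exact: cell_perm_lt.
Qed.

Lemma shuffled_sumE k x y (y' : 'rV[R]_d) : cube_co 1 y' ->
  shuffled p u0 k x y y' =
  \sum_(g : {ffun 'I_d -> 'I_(M k)})
    cell_value k (fun i => g i) (x, y) * \1_(subcube p k (\row_i (g i)%:R)) y'.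
Proof.
move=> /(subcube_ex p_gt0 p_mult k)[b by'].
pose g : {ffun 'I_d -> 'I_(M k)} := finfun b.
have gy' : subcube p k (\row_i (g i)%:R) y'.
  rewrite (_ : \row_i (g i)%:R = \row_i (b i)%:R) //.
  by apply/rowP => i; rewrite !mxE ffunE.
rewrite (bigD1 g) //= indicE mem_set // mulr1 big1 ?addr0 => [|g' g'g]; last first.
  rewrite indicE memNset ?mulr0 // => g'y'; move/eqP: g'g; apply.
  by apply/ffunP => i; apply/val_inj; exact: subcube_inj g'y' gy' i.
by rewrite (shuffled_cell p_gt0 p_mult u0 x y _ gy') // => i.
Qed.

Section averages.
Variables (Omega : set 'rV[R]_d) (eps : nat -> R) (u : nat -> 'rV[R]_d -> R).
Hypotheses (mO : measurable Omega) (Ooo : (mu Omega < +oo)%E).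
Hypothesis u0_cvg : forall n, two_scale_cvg Omega (p n) eps u (u0 n).

(** The shifts [cell_perm n.+1 g] of the subcells [g] of the cell [b] are
    [cell_perm n b + M n * j] with [j] in [{0, .., m n - 1}^d], so this is the
    averaging over multiples of [p n], at the point shifted by [cell_perm n b]. *)
Lemma cell_average_step n (b : 'I_d -> nat) : (forall i, b i < M n)%N ->
  {ae nu, forall z, (Omega `*` cube_co (p 0%N)) z -> cell_value n b z =
    ((m n)%:R ^+ d)^-1 *
    \sum_(g : {ffun 'I_d -> 'I_(M n.+1)} | [forall i, g i %/ m n == b i]%N)
      cell_value n.+1 (fun i => g i) z}.
Proof.
move=> bM; have m0 := step_ratio_gt0 p_gt0 p_mult n.
have := u0_cvg n.+1; rewrite (step_ratioE p_gt0 p_mult) => U_cvg.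
have := two_scale_average mO Ooo (p_gt0 n) m0 (u0_cvg n) U_cvg.
move=> /(ae_translate2 (p 0%N *: \row_i (cell_perm p n (b i))%:R)).
apply: filterS => z avg [zO zp]; rewrite /cell_value avg /=; last first.
  by split => //=; exact: cell_shift_cube.
congr (_ * _).
have lt_M (j : {ffun 'I_d -> 'I_(m n)}) i : (b i * m n + j i < M n.+1)%N.
  rewrite period_ratioS //; have := bM i; have := ltn_ord (j i).
  by move: (nat_of_ord _) => r; nia.
pose h (j : {ffun 'I_d -> 'I_(m n)}) : {ffun 'I_d -> 'I_(M n.+1)} :=
  [ffun i => Ordinal (lt_M j i)].
pose h' (g : {ffun 'I_d -> 'I_(M n.+1)}) : {ffun 'I_d -> 'I_(m n)} :=
  [ffun i => Ordinal (ltn_pmod (g i) m0)].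
rewrite [RHS](reindex_onto h h') => [|g /forallP gb]; last first.
  apply/ffunP => i; apply/val_inj; rewrite !ffunE /= ffunE /=.
  by rewrite [RHS](divn_eq _ (m n)) (eqP (gb i)).
rewrite [RHS](eq_bigl xpredT) => [|j]; last first.
  apply/andP; split.
    apply/forallP => i; rewrite ffunE /= divnMDl // divn_small ?addn0 //.
  apply/eqP/ffunP => i; apply/val_inj; rewrite !ffunE /= ?ffunE /= modnMDl.
  by rewrite modn_small.
apply: eq_bigr => j _; congr (u0 _ _ _); rewrite -addrA; congr (_ + _).
apply/rowP => i; rewrite !mxE ffunE /= divnMDl // divn_small // addn0.
rewrite modnMDl modn_small // natrD natrM (period_ratioE p_gt0 p_mult n).
by ring.
Qed.

(** The value of the [n]-th shuffled function on a cell is the average of the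
    values of the [k]-th one over the subcells. *)
Lemma cell_average n k (b : 'I_d -> nat) : (n <= k)%N -> (forall i, b i < M n)%N ->
  {ae nu, forall z, (Omega `*` cube_co (p 0%N)) z -> cell_value n b z =
    (M n)%:R ^+ d / (M k)%:R ^+ d *
    \sum_(g : {ffun 'I_d -> 'I_(M k)} | [forall i, g i %/ (M k %/ M n) == b i]%N)
      cell_value k (fun i => g i) z}.
Proof.
(* Induction on [k - n], with [k] fixed. *)
move=> /subnK kE; move: (k - n)%N kE b => l.
elim: l n => [|l IH] n; rewrite ?add0n ?addSnnS.
  move=> <- b bM; apply: aeW => z _.
  rewrite divff ?expf_neq0 ?gt_eqF // mul1r divnn period_ratio_gt0 //.
  pose g0 : {ffun 'I_d -> 'I_(M n)} := [ffun i => Ordinal (bM i)].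
  rewrite (big_pred1 g0) => [|g].
    rewrite /cell_value; congr (u0 _ _ (_ + _ *: _)).
    by apply/rowP => i; rewrite !mxE ffunE.
  apply/forallP/eqP => [gb|-> i]; last by rewrite ffunE divn1.
  apply/ffunP => i; apply/val_inj; rewrite ffunE /=.
  by rewrite -[LHS]divn1; exact/eqP/gb.
move=> kE b bM; have nk : (n.+1 <= k)%N by rewrite -kE leq_addl.
have avgS : {ae nu, forall z, forall g : {ffun 'I_d -> 'I_(M n.+1)},
    (Omega `*` cube_co (p 0%N)) z -> cell_value n.+1 (fun i => g i) z =
    (M n.+1)%:R ^+ d / (M k)%:R ^+ d *
    \sum_(g' : {ffun 'I_d -> 'I_(M k)} | [forall i, g' i %/ (M k %/ M n.+1) == g i]%N)
      cell_value k (fun i => g' i) z}.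
  apply: filter_forall => g; exact: (IH n.+1 kE (fun i => g i)).
apply: filterS2 (cell_average_step bM) avgS => z step avg zO.
rewrite (step zO) (eq_bigr _ (fun g _ => avg g zO)) -big_distrr /= mulrA.
have m0 := step_ratio_gt0 p_gt0 p_mult n.
have mR0 : 0 < (m n)%:R :> R by rewrite ltr0n.
congr (_ * _).
  rewrite period_ratioS // natrM exprMn; field.
  by rewrite !expf_neq0 // gt_eqF.
have Mdvd := period_ratio_dvd nk.
have DE : (M k %/ M n = (M k %/ M n.+1) * m n)%N.
  rewrite -{1}(divnK Mdvd) (period_ratioS p_gt0 p_mult n) mulnCA mulnC.
  by rewrite mulnK ?mulnA // period_ratio_gt0.
have D0 : (0 < M k %/ M n.+1)%N.
  have Mk0N := period_ratio_gt0 p_gt0 p_mult k.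
  have Mn0N := period_ratio_gt0 p_gt0 p_mult n.+1.
  by rewrite divn_gt0 // dvdn_leq.
have lt_M (g : {ffun 'I_d -> 'I_(M k)}) i : (g i %/ (M k %/ M n.+1) < M n.+1)%N.
  by rewrite ltn_divLR // [X in (_ < X)%N]mulnC divnK.
pose P (g : {ffun 'I_d -> 'I_(M k)}) : {ffun 'I_d -> 'I_(M n.+1)} :=
  [ffun i => Ordinal (lt_M g i)].
rewrite [RHS](partition_big P
  (fun g : {ffun 'I_d -> 'I_(M n.+1)} => [forall i, g i %/ m n == b i]%N)) /=.
  apply: eq_bigr => g /forallP gb; apply: eq_bigl => g'.
  apply/forallP/andP => [gg'|[_ /eqP <-] i]; last by rewrite ffunE.
  split; last by apply/eqP/ffunP => i; apply/val_inj; rewrite ffunE /=; exact/eqP.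
  by apply/forallP => i; rewrite DE divnMA (eqP (gg' i)).
move=> g /forallP gb; apply/forallP => i; rewrite ffunE /= -divnMA -DE.
exact: gb.
Qed.

End averages.
End cell_averages.

(** * Recovering cell values from the shuffle limit *)

Section recovery.
Context {R : realType} {d : nat}.
Local Notation mu := (@lebesgue_rV R d).
Local Notation nu := (mu \x mu)%E.
Variable p : nat -> R.
Hypothesis p_gt0 : forall n, 0 < p n.
Hypothesis p_mult : forall n, exists k : int, p n.+1 = k%:~R * p n.
Variables (u0 : nat -> 'rV[R]_d -> 'rV[R]_d -> R).
Variables (Omega : set 'rV[R]_d) (eps : nat -> R) (u : nat -> 'rV[R]_d -> R).
Hypotheses (mO : measurable Omega) (Ooo : (mu Omega < +oo)%E).
Hypothesis u0_cvg : forall n, two_scale_cvg Omega (p n) eps u (u0 n).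

Local Notation M := (period_ratio p).
Local Notation cell n b := (subcube p n (\row_i (b i)%:R)).

(** [u0 k] is only known to be measurable on [Omega] times the period cell, which
    contains the shifted cube. *)
Lemma measurable_cell_value k (g : 'I_d -> nat) : (forall i, g i < M k)%N ->
  measurable_fun setT (cell_value p u0 k g \_ (Omega `*` cube_co (p 0%N))).
Proof.
move=> gM; have [_ uL2 _] := u0_cvg k.
pose F := (fun z : 'rV[R]_d * 'rV[R]_d => u0 k z.1 z.2) \_ (Omega `*` cube_co (p k)).
have mF : measurable_fun setT F.
  by apply/measurable_EFinP; exact: measurable_int (integrable_cell mO Ooo uL2).
pose c := p 0%N *: \row_i (cell_perm p k (g i))%:R : 'rV[R]_d.
have mS : measurable (Omega `*` cube_co (p 0%N) : set ('rV[R]_d * 'rV[R]_d)).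
  by apply: measurableX => //; exact: measurable_cube_co.
rewrite (_ : _ \_ _ = (F \o translate2 c) \_ (Omega `*` cube_co (p 0%N))).
  apply/(measurable_restrictT _ mS)/measurable_funTS.
  by apply: measurableT_comp => //; exact: measurable_translate2.
apply/funext => z; rewrite !patchE; case: ifPn => // /set_mem[zO zp].
rewrite /= /F patchE mem_set //; split => //=; exact: cell_shift_cube.
Qed.

Lemma lebesgue_cellI n k (b : 'I_d -> nat) (g : {ffun 'I_d -> 'I_(M k)}) :
  (n <= k)%N ->
  mu (cell k g `&` cell n b) =
  (if [forall i, g i %/ (M k %/ M n) == b i]%N then (M k)%:R ^- d else 0)%:E.
Proof.
move=> nk; case: ifPn => [/forallP gb|gb].
  rewrite setIidl ?lebesgue_subcube // => y /(subcube_coarsen p_gt0 p_mult nk).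
  rewrite (_ : \row_i _ = \row_i (b i)%:R) //; apply/rowP => i.
  by rewrite !mxE (eqP (gb i)).
rewrite (_ : _ `&` _ = set0) ?measure0 //; apply/seteqP; split => // y [yg yb].
move/negP: gb; apply; apply/forallP => i; apply/eqP.
exact: (subcube_inj p_gt0 p_mult (subcube_coarsen p_gt0 p_mult nk yg) yb i).
Qed.

(** The value of the [n]-th shuffled function on a cell is the average of the
    shuffle limit over that cell. *)
Lemma shuffle_limit_average n (b : 'I_d -> nat) winf : (forall i, b i < M n)%N ->
  is_shuffle_limit p Omega u0 winf ->
  {ae nu, forall z, (Omega `*` cube_cc (p 0%N)) z -> cell_value p u0 n b z =
     (M n)%:R ^+ d * \int[mu]_(z' in cell n b) winf z.1 z.2 z'}.
Proof.
move=> bM [wL2 s_cvg _].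
have Mn0 : 0 < (M n)%:R :> R by rewrite ltr0n; exact: period_ratio_gt0.
pose S : set ('rV[R]_d * 'rV[R]_d) := Omega `*` cube_co (p 0%N).
pose D : set ('rV[R]_d * 'rV[R]_d * 'rV[R]_d) :=
  (Omega `*` cube_cc (p 0%N)) `*` cube_cc 1.
pose C : set 'rV[R]_d := cell n b.
(* On [E] all the shuffled functions are given by their cell values; on the
   outer faces of [D], which are negligible, they may not be. *)
pose E := S `*` C.
have mC : measurable C by exact: measurable_subcube.
have mS : measurable S by apply: measurableX => //; exact: measurable_cube_co.
have mE : measurable E by exact: measurableX.
have mD : measurable D.
  apply: measurableX; last exact: measurable_cube_cc.
  by apply: measurableX => //; exact: measurable_cube_cc.
have C1 : C `<=` cube_co 1 by exact: subcube_sub_cube.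
have ED : E `<=` D.
  move=> z [[zO zp] zC]; split; last exact/cube_co_sub_cc/C1.
  by split => //; exact: cube_co_sub_cc.
have Doo : ((nu \x mu)%E D < +oo)%E.
  have mcc (q : R) := @measurable_cube_cc R d q.
  have cc_fin (q : R) : mu (cube_cc q) \is a fin_num.
    by rewrite ge0_fin_numE // lebesgue_cube_cc_lt_pinfty.
  have O_fin : mu Omega \is a fin_num by rewrite ge0_fin_numE.
  rewrite /D product_measure1E //; last by apply: measurableX => //; exact: mcc.
  by rewrite /= product_measure1E // -ge0_fin_numE ?mule_ge0 // !fin_numM.
have Eoo : ((nu \x mu)%E E < +oo)%E.
  by apply: le_lt_trans Doo; apply: le_measure; rewrite ?inE.
pose w (z : 'rV[R]_d * 'rV[R]_d * 'rV[R]_d) := winf z.1.1 z.1.2 z.2.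
have wEi : (nu \x mu)%E.-integrable setT (EFin \o (w \_ E)).
  have wi := integrableS measurableT mE (@subsetT _ _) (L2_integrable mD Doo wL2).
  move/(integrable_mkcond _ mE) : wi; apply: eq_integrable => // z _.
  rewrite /= !patchE; case: ifPn => // /set_mem zE.
  by rewrite /= patchE mem_set //; exact: ED.
pose s k (z : 'rV[R]_d * 'rV[R]_d * 'rV[R]_d) := shuffled p u0 k z.1.1 z.1.2 z.2.
have sE k z z' : (s k \_ E) (z, z') = \sum_(g : {ffun 'I_d -> 'I_(M k)})
    (cell_value p u0 k (fun i => g i) \_ S) z * \1_(cell k g `&` C) z'.
  rewrite patchE in_setX; have [zS|zS] := boolP (z \in S); last first.
    by rewrite big1 // => g _; rewrite patchE (negbTE zS) mul0r.
  have [zC|zC] := boolP (z' \in C); last first.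
    rewrite big1 // => g _; rewrite indicE memNset ?mulr0 // => -[_ /mem_set].
    exact/negP.
  rewrite /= /s (shuffled_sumE p_gt0 p_mult); last exact/C1/set_mem.
  apply: eq_bigr => g _; rewrite patchE zS -surjective_pairing; congr (_ * _).
  by rewrite !indicE in_setI zC andbT.
have ms k : measurable_fun setT (s k \_ E).
  rewrite (_ : _ \_ _ = fun z => \sum_(g : {ffun 'I_d -> 'I_(M k)})
    (cell_value p u0 k (fun i => g i) \_ S) z.1 * \1_(cell k g `&` C) z.2).
    apply: measurable_sum => g; apply: measurable_funM.
      apply: measurableT_comp => //; exact: measurable_cell_value.
    apply: measurableT_comp => //; apply: measurable_indic.
    by apply: measurableI => //; exact: measurable_subcube.
  by apply/funext => -[z z']; exact: sE.
pose h k z := s k z - w z.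
have hE k z : (h k \_ E) z = (s k \_ E) z - (w \_ E) z.
  by rewrite !patchE; case: ifP => // _; rewrite subr0.
have mh k : measurable_fun setT (h k \_ E).
  rewrite (_ : _ \_ _ = (s k \_ E) \- (w \_ E)).
    by apply: measurable_funB => //; apply/measurable_EFinP; exact: measurable_int wEi.
  by apply/funext => z; exact: hE.
have h_cvg := L1_cvg0_of_L2norm ED mE Eoo mh s_cvg.
have avg : {ae nu, forall z, forall k, S z -> (n <= k)%N ->
    cell_value p u0 n b z / (M n)%:R ^+ d = (M k)%:R ^- d *
    \sum_(g : {ffun 'I_d -> 'I_(M k)} | [forall i, g i %/ (M k %/ M n) == b i]%N)
      cell_value p u0 k (fun i => g i) z}.
  apply: ae_foralln => k; have [nk|nk] := leqP n k; last by apply: aeW.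
  apply: filterS (cell_average p_gt0 p_mult mO Ooo u0_cvg nk bM) => z avg Sz _.
  have Mk0 : 0 < (M k)%:R :> R by rewrite ltr0n; exact: period_ratio_gt0.
  rewrite avg //; set t := \sum_(_ | _) _; field.
  by rewrite !expf_neq0 // gt_eqF.
have msub g k : measurable (cell k (g : 'I_d -> nat) `&` C).
  by apply: measurableI => //; exact: measurable_subcube.
have Coo : (mu C < +oo)%E by rewrite /C lebesgue_subcube // ltry.
have i_ind (g : 'I_d -> nat) k :
    mu.-integrable setT (EFin \o (\1_(cell k g `&` C) : _ -> R)).
  apply/integrableP; split; first exact/measurable_EFinP/measurable_indic.
  rewrite (eq_integral (fun x => (\1_(cell k g `&` C) x)%:E)); last first.
    by move=> t _; rewrite gee0_abs // lee_fin indicE.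
  rewrite integral_indic // setIT; apply: le_lt_trans Coo.
  by apply: le_measure; rewrite ?inE.
have sEF k z : (fun z' => ((s k \_ E) (z, z'))%:E) = (fun z' =>
    \sum_(g : {ffun 'I_d -> 'I_(M k)})
    ((cell_value p u0 k (fun i => g i) \_ S) z)%:E *
    (EFin \o (\1_(cell k g `&` C) : _ -> R)) z')%E.
  apply/funext => z'; rewrite sE -sumEFin; apply: eq_bigr => g _.
  by rewrite EFinM.
have si k z : mu.-integrable setT (fun z' => ((s k \_ E) (z, z'))%:E).
  rewrite sEF; apply: integrable_sum => // g _; exact: integrableZl.
have : {ae nu, forall z, S z -> cell_value p u0 n b z / (M n)%:R ^+ d =
    \int[mu]_z' (w \_ E) (z, z')}.
  apply: (@ae_section_integral_limit _ _ _ _ _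
    (sigma_finite_prod_measure mu mu)
    mu (fun k => s k \_ E) (w \_ E) S
    (fun z => cell_value p u0 n b z / (M n)%:R ^+ d) n ms si wEi).
    apply: cvg_trans h_cvg; apply: near_eq_cvg; apply: nearW => k.
    by apply: eq_integral => z _; rewrite hE.
  apply: filterS avg => z avg Sz k nk.
  rewrite sEF integral_sum => [|//|g]; last exact: integrableZl.
  rewrite (avg k Sz nk) big_distrr /= -sumEFin [in RHS]big_mkcond /=; apply: eq_bigr => g _.
  rewrite integralZl //; last exact: i_ind.
  rewrite integral_indic // setIT [X in (_ * X)%E](lebesgue_cellI b g nk).
  rewrite patchE mem_set // -EFinM; case: ifP => _; first by rewrite mulrC.
  by rewrite mulr0.
apply: filterS2 (ae_cube_co mO (p 0%N)) => z zp avgw zcc.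
have Sz : S z by split; [case: zcc|exact: zp].
have := avgw Sz.
rewrite (_ : \int[mu]_z' (w \_ E) (z, z') = \int[mu]_(z' in C) winf z.1 z.2 z').
  by move=> <-; rewrite mulrC divfK // expf_neq0 // gt_eqF.
rewrite [RHS]Rintegral_mkcond; apply: eq_Rintegral => z' _.
by rewrite !patchE in_setX mem_set.
Qed.

End recovery.

Theorem corollary3p9 (R : realType) (d : nat) (hd : (0 < d)%N)
  (Omega : set 'rV[R]_d) (Omega_open : open Omega)
  (Omega_bounded : bounded_set Omega)
  (u : R -> 'rV[R]_d -> R)
  (u_L2 : forall e : R, 0 < e -> L2 (lebesgue_rV d) Omega (u e))
  (u_bounded : exists C : R, forall e : R, 0 < e ->
    (L2norm (lebesgue_rV d) Omega (u e) <= C%:E)%E)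
  (p : nat -> R) (p_gt0 : forall n, 0 < p n)
  (p_incr : nondecreasing_seq p)
  (p_mult : forall n, exists k : int, p n.+1 = k%:~R * p n)
  (eps : nat -> R) (eps_gt0 : forall k, 0 < eps k)
  (eps_decr : nonincreasing_seq eps)
  (eps_cvg : eps @ \oo --> (0 : R))
  (u0 : nat -> 'rV[R]_d -> 'rV[R]_d -> R)
  (u0_cvg : forall n,
    two_scale_cvg Omega (p n) eps (fun k => u (eps k)) (u0 n))
  (winf : 'rV[R]_d -> 'rV[R]_d -> 'rV[R]_d -> R)
  (winf_lim : is_shuffle_limit p Omega u0 winf) :
  forall n,
  [/\ forall (beta : 'I_d -> 'I_(period_ratio p n)) (y' : 'rV[R]_d),
        subcube p n (\row_i (beta i)%:R) y' ->
        {ae (lebesgue_rV d \x lebesgue_rV d)%E, forall z,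
          (Omega `*` cube_cc (p 0%N)) z ->
          shuffled p u0 n z.1 z.2 y' =
          (period_ratio p n)%:R ^+ d *
            \int[lebesgue_rV d]_(z' in subcube p n (\row_i (beta i)%:R))
              winf z.1 z.2 z'},
      set_bij (cube_co 1) (cube_co 1) (@shuffle_rV R d p n) /\
      (forall x y y', Omega x -> cube_cc (p 0%N) y -> cube_co 1 y' ->
        rearr p u0 n x y y' =
        shuffled p u0 n x y (pinv (cube_co 1) (@shuffle_rV R d p n) y')) &
      {ae (lebesgue_rV d \x lebesgue_rV d)%E, forall z,
        (Omega `*` cube_co (p n)) z ->
        let b := floor_rV ((p 0%N)^-1 *: z.2) in
        rearr p u0 n z.1 (z.2 - p 0%N *: b) @` subcube p n b
          = [set u0 n z.1 z.2]}].
Proof.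
have mO := open_measurable_rV Omega_open.
have Ooo := bounded_lebesgue_lt_pinfty mO Omega_bounded.
move=> n; split.
- move=> beta y' by'; have bM i := ltn_ord (beta i).
  apply: filterS (shuffle_limit_average p_gt0 p_mult mO Ooo u0_cvg bM winf_lim).
  move=> z avg zD; rewrite (shuffled_cell p_gt0 p_mult u0 z.1 z.2 bM by') -avg //.
- split; first exact: shuffle_rV_bij.
  by move=> x y y' _ _ y'1; exact: rearr_shuffled.
- by apply: aeW => z [_ zp]; exact: rearr_subcube.
Qed.
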